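(* Given a Vogan diagram of classical type having just one painted node, assume that $\varphi$ belongs to the associated dominant Weyl chamber $C$ and that it is special and integrable. Then, up to isomorphism of diagrams, the Vogan diagram is one of the following: - any diagram of type $A_\ell$ (with one painted node); - type $B_\ell$ with $\gamma_\ell$ painted, where the nodes form a chain $\gamma_1,\dots,\gamma_\ell$, with $\gamma_1$ the short simple root, joined to $\gamma_2$ by a double edge (so $\gamma_\ell$ is the end of the diagram opposite to $\gamma_1$); - type $C_\ell$ with $\gamma_\ell$ painted, where the nodes form a chain $\gamma_1,\dots,\gamma_\ell$, with $\gamma_\ell$ the long simple root, joined to $\gamma_{\ell-1}$ by a double edge; - type $D_\ell$ with $\gamma_1$ painted, or type $D_\ell$ with $\gamma_{\ell-1}$ painted, where $\gamma_1,\dots,\gamma_{\ell-2}$ form a chain and $\gamma_{\ell-1},\gamma_\ell$ are both joined to $\gamma_{\ell-2}$. Moreover, $\varphi$ coincides up to scaling with the fundamental dominant weight corresponding to the painted node.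
   Context: A Vogan diagram here means a Dynkin diagram with some painted vertices (trivial automorphism); it is of classical type if the underlying Dynkin diagram is of type $A_\ell$, $B_\ell$, $C_\ell$ or $D_\ell$. It determines a real semisimple Lie algebra $\mathfrak g$ with Cartan decomposition $\mathfrak g=\mathfrak k\oplus\mathfrak p$, a maximal abelian subalgebra $\mathfrak h_0\subset\mathfrak k$ whose complexification is a Cartan subalgebra of $\mathfrak g_c=\mathfrak g\otimes\mathbf C$, a root system $\Delta$ and a positive system $\Delta^+$ with simple roots $\gamma_1,\dots,\gamma_\ell$ corresponding to the nodes, such that $\gamma_i$ is non-compact exactly when its node is painted. A root $\alpha$ is compact ($\varepsilon_\alpha=-1$) if its root space $\mathfrak g^\alpha$ lies in $\mathfrak k_c$, non-compact ($\varepsilon_\alpha=1$) if it lies in $\mathfrak p_c$. Let $B$ be the Killing form, positive definite on $\mathfrak h_{\mathbf R}=i\mathfrak h_0$; for $\psi\in\mathfrak h_{\mathbf R}^*$, $h_\psi$ satisfies $\psi(h)=B(h_\psi,h)$ on $\mathfrak h_{\mathbf R}$, and $(\psi,\psi')=B(h_\psi,h_{\psi'})$. The fundamental dominant weights are $\varphi_j=\sum_iA^{ij}\gamma_i$, with $(A^{ij})$ the inverse of the Cartan matrix $A_{ij}=2(\gamma_i,\gamma_j)/(\gamma_i,\gamma_i)$. $C=\{\psi:(\psi,\alpha)\ge0\ \forall\alpha\in\Delta^+\}$. Let $G$ be a Lie group with Lie algebra $\mathfrak g$. The notions ''special'' and ''integrable'' concern $\varphi\in C$ such that $v=ih_\varphi$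 has compact stabilizer $V\subset G$ under the adjoint action. Let $\mathfrak m\cong T_e(G/V)$ be the $B$-orthogonal complement of the Lie algebra of $V$. The orbit $G/V$ carries the $G$-invariant Kirillov-Kostant-Souriau symplectic form $\omega$, given at the identity coset by $B(v,[x,y])$, $x,y\in\mathfrak m$. One has $\mathfrak m=\bigoplus\mathfrak m_\alpha$ over $\alpha\in\Delta^+$ with $(\varphi,\alpha)\ne0$, $\mathfrak m_\alpha=(\mathfrak g^\alpha\oplus\mathfrak g^{-\alpha})\cap\mathfrak g$, and the canonical $\omega$-compatible $G$-invariant almost complex structure $J$ acts on $\mathfrak m_\alpha$ by $x\mapsto\frac{\varepsilon_\alpha}{(\varphi,\alpha)}[v,x]$. $\varphi$ is integrable if $J$ is integrable. The Chern connection is the unique affine connection $\nabla$ with $\nabla\omega=0$, $\nabla J=0$ and torsion equal to $N$, where $4N(X,Y)=[JX,JY]-J[JX,Y]-J[X,JY]-[X,Y]$; with curvature $R$, the Chern-Ricci form is $\rho(X,Y)=\mathrm{tr}(JR(X,Y))$. $\varphi$ is special if $\rho=\lambda\omega$ for some real constant $\lambda$; equivalently $-2\sum_{\alpha\in\Delta^+,\,(\varphi,\alpha)\ne0}\varepsilon_\alpha\alpha=\lambda\varphi$. *)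

(* Defs.v *)
From HB Require Import structures.
From mathcomp Require Import all_boot all_order all_fingroup all_algebra.
From mathcomp Require Import all_classical all_reals all_analysis.

Set Implicit Arguments.
Unset Strict Implicit.
Unset Printing Implicit Defensive.

Import Order.TTheory GRing.Theory Num.Theory.
Import numFieldNormedType.Exports.

Local Open Scope classical_set_scope.
Local Open Scope ring_scope.

(** * Dynkin and Vogan diagrams *)

(* A Dynkin diagram is encoded by its Cartan matrix, with the convention
   A i j = 2 (gamma_i, gamma_j) / (gamma_i, gamma_i); hence A i j = -2 and
   A j i = -1 on a double edge joining a short root i to a long root j. *)
Record vogan_diagram (l : nat) := VoganDiagram {
  vd_cartan : 'M[int]_l;
  vd_painted : {set 'I_l}
}.

Definition dynkin_iso (l : nat) (A A' : 'M[int]_l) (s : 'S_l) : Prop :=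
  forall i j, A' (s i) (s j) = A i j.

Definition vogan_iso (l : nat) (D D' : vogan_diagram l) : Prop :=
  exists s : 'S_l, dynkin_iso (vd_cartan D) (vd_cartan D') s /\
    vd_painted D' = [set s i | i in vd_painted D]%SET.

Inductive classical_type := TypeA | TypeB | TypeC | TypeD.

(* The duplicates B_2 = C_2 and A_3 = D_3 are allowed. *)
Definition classical_rank (X : classical_type) (l : nat) : bool :=
  match X with
  | TypeA => (1 <= l)%N
  | TypeB => (2 <= l)%N
  | TypeC => (2 <= l)%N
  | TypeD => (3 <= l)%N
  end.

Definition chain_edge (i j : nat) : bool := (j == i.+1) || (i == j.+1).

(* Nodes are numbered from 0: the node gamma_i of the literature has index
   i - 1.  In type B the first root is short, in type C the last one is long,
   in type D the last two nodes are joined to the antepenultimate one. *)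
Definition classical_cartan_entry (X : classical_type) (l i j : nat) : int :=
  if i == j then 2 else
  match X with
  | TypeA => - (chain_edge i j)%:R
  | TypeB => if (i == 0)%N && (j == 1)%N then - 2 else - (chain_edge i j)%:R
  | TypeC => if (i.+2 == l)%N && (j.+1 == l)%N then - 2
             else - (chain_edge i j)%:R
  | TypeD => - ([|| [&& chain_edge i j, (i.+1 < l)%N & (j.+1 < l)%N],
                    (i.+1 == l)%N && (j.+3 == l)%N
                  | (j.+1 == l)%N && (i.+3 == l)%N])%:R
  end.

Definition classical_cartan (X : classical_type) (l : nat) : 'M[int]_l :=
  \matrix_(i < l, j < l) classical_cartan_entry X l i j.

Definition of_classical_type (l : nat) (D : vogan_diagram l) : Prop :=
  exists (X : classical_type) (s : 'S_l), classical_rank X l /\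
    dynkin_iso (vd_cartan D) (classical_cartan X l) s.

(* Any node in type A; gamma_l in types B and C; gamma_1 or gamma_(l-1) in
   type D. *)
Definition listed_node (X : classical_type) (l : nat) (i : 'I_l) : bool :=
  match X with
  | TypeA => true
  | TypeB => (i.+1 == l)%N
  | TypeC => (i.+1 == l)%N
  | TypeD => (i == 0 :> nat) || (i.+2 == l)%N
  end.

(** * Real Lie algebras *)

Record lie_algebra (R : realType) := LieAlgebra {
  lie_space :> vectType R;
  br : 'Hom(lie_space, 'End(lie_space));
  br_alt : forall x, br x x = 0;
  br_jacobi : forall x y z, br x (br y z) + br y (br z x) + br z (br x y) = 0
}.

(* The trace on U of an endomorphism that maps U into U. *)
Definition trace_on (R : realType) (V : vectType R) (U : {vspace V})
    (f : V -> V) : R :=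
  \sum_(i < \dim U) coord (vbasis U) i (f (vbasis U)`_i).

Section LieAlgebras.
Variables (R : realType) (g : lie_algebra R).
Implicit Types (x y : g) (U k p : {vspace g}) (z w : (g * g)%type).

Definition killing x y : R :=
  trace_on fullv (fun u => br g x (br g y u)).

Definition killing_orth U : {vspace g} :=
  (\bigcap_(i < \dim U)
     lker (linfun (fun y => killing (vbasis U)`_i y : R^o)))%VS.

Definition semisimple : Prop :=
  forall U, (forall x y, y \in U -> br g x y \in U) ->
    (forall x y, x \in U -> y \in U -> br g x y = 0) -> U = 0%VS.

Definition cartan_decomposition k p : Prop :=
  [/\ (k + p)%VS = fullv, (k :&: p)%VS = 0%VS,
      [/\ forall x y, x \in k -> y \in k -> br g x y \in k,
          forall x y, x \in k -> y \in p -> br g x y \in p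
        & forall x y, x \in p -> y \in p -> br g x y \in k],
      forall x, x \in k -> x != 0 -> killing x x < 0
    & forall x, x \in p -> x != 0 -> 0 < killing x x].

(** The complexification g_c is g * g, the pair (x, y) standing for x + i y;
    real scalars act componentwise. *)
Definition cbr z w : (g * g)%type :=
  (br g z.1 w.1 - br g z.2 w.2, br g z.1 w.2 + br g z.2 w.1).

Definition in_complexification U z : Prop := z.1 \in U /\ z.2 \in U.

(* Being abelian, the complexification of h0 is a nilpotent subalgebra; it is
   a Cartan subalgebra when it is moreover its own normalizer. *)
Definition compact_cartan k (h0 : {vspace g}) : Prop :=
  [/\ (h0 <= k)%VS,
      forall x y, x \in h0 -> y \in h0 -> br g x y = 0,
      forall x, x \in k -> (forall t, t \in h0 -> br g t x = 0) -> x \in h0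
    & forall z, (forall w, in_complexification h0 w ->
                   in_complexification h0 (cbr z w)) ->
        in_complexification h0 z].

End LieAlgebras.

(** * Roots and weights *)

(* The real space h_R = i h_0 is parametrized by h_0 through t |-> i t, so that
   h_R^* is the space of linear forms on h_0, psi t standing for psi (i t). *)
Notation weight R h0 := 'Hom(subvs_of h0, R^o).

Section Roots.
Variables (R : realType) (g : lie_algebra R) (k p h0 : {vspace g}).
Implicit Types (t : subvs_of h0) (z : (g * g)%type) (psi al : weight R h0).

Definition killingR t t' : R := - killing (vsval t) (vsval t').

Definition hvec psi : subvs_of h0 :=
  xget 0 [set t | forall t', psi t' = killingR t t'].

Definition wform psi psi' : R := killingR (hvec psi) (hvec psi').

(* v = i h_psi, where h_psi = i (hvec psi). *)
Definition ivec psi : g := - vsval (hvec psi).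

Definition root_space al : set (g * g)%type :=
  [set z | forall t, cbr (0, vsval t) z = al t *: z].

Definition is_root al : Prop :=
  al != 0 /\ exists2 z, root_space al z & z != 0.

Definition compact_root al : Prop :=
  forall z, root_space al z -> in_complexification k z.

Definition noncompact_root al : Prop :=
  forall z, root_space al z -> in_complexification p z.

Definition eps al : R := if `[< noncompact_root al >] then 1 else -1.

Section SimpleRoots.
Variables (l : nat) (gamma : 'I_l -> weight R h0).

Definition positive_root al : Prop :=
  is_root al /\ exists c : 'I_l -> nat, al = \sum_(i < l) gamma i *+ c i.

Definition simple_roots : Prop :=
  [/\ forall i, is_root (gamma i),
      basis_of fullv [seq gamma i | i : 'I_l]
    & forall al, is_root al -> positive_root al \/ positive_root (- al)].

Definition cartan_matrix : 'M[R]_l :=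
  \matrix_(i, j) (2 * wform (gamma i) (gamma j) / wform (gamma i) (gamma i)).

Definition fundamental_weight (j : 'I_l) : weight R h0 :=
  \sum_(i < l) invmx cartan_matrix i j *: gamma i.

Definition has_vogan_diagram (D : vogan_diagram l) : Prop :=
  (forall i j, cartan_matrix i j = (vd_cartan D i j)%:~R) /\
  (forall i, i \in vd_painted D <-> noncompact_root (gamma i)).

Definition dominant psi : Prop :=
  forall al, positive_root al -> 0 <= wform psi al.

End SimpleRoots.

(* (g^al + g^(-al)) :&: g, with g embedded in g_c by x |-> (x, 0). *)
Definition mspace al : set g :=
  [set x | exists z w, [/\ root_space al z, root_space (- al) w
                         & (x, 0) = z + w]].

End Roots.

(** * Lie groups *)

#[short(type="preTopologicalGroupType")]
HB.structure Definition PreTopologicalGroup :=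
  {G of Topological G & monoid.Group G}.

Definition lie_coords (R : realType) (g : lie_algebra R)
    (u : 'rV[R]_(\dim (fullv : {vspace g}))) : g :=
  \sum_i u 0 i *: (vbasis (fullv : {vspace g}))`_i.

(* G is a Lie group with Lie algebra g.  The smooth structure enters only
   through the exponential map, which is a homeomorphism from a neighbourhood
   of 0 onto a neighbourhood of the identity (hence a chart), and through the
   adjoint representation, whose differential is the bracket. *)
Record lie_group (R : realType) (g : lie_algebra R)
    (G : preTopologicalGroupType) := LieGroup {
  gexp : g -> G;
  Ad : G -> 'End(g);
  lie_hausdorff : hausdorff_space G;
  mulg_continuous : continuous (fun ab : G * G => (ab.1 * ab.2)%g);
  invg_continuous : continuous (fun a : G => a^-1%g);
  gexp_continuous : continuous (fun u => gexp (lie_coords u));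
  gexp_local_homeo : exists2 U : set 'rV[R]_(\dim (fullv : {vspace g})),
    open U /\ U 0 &
    {in U &, injective (fun u => gexp (lie_coords u))} /\
    forall W, W `<=` U ->
      (open W <-> open ((fun u => gexp (lie_coords u)) @` W));
  gexp_add : forall (s t : R) (x : g),
    gexp ((s + t) *: x) = (gexp (s *: x) * gexp (t *: x))%g;
  Ad1 : Ad 1%g = \1%VF;
  AdM : forall a b, Ad (a * b)%g = (Ad a \o Ad b)%VF;
  Ad_br : forall a x y, Ad a (br g x y) = br g (Ad a x) (Ad a y);
  Ad_continuous : forall (xi : 'Hom(g, R^o)) (y : g),
    continuous (fun a => xi (Ad a y) : R^o);
  gexp_Ad : forall a x, (a * gexp x * a^-1)%g = gexp (Ad a x);
  Ad_gexp : forall (xi : 'Hom(g, R^o)) (x y : g) (t : R),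
    is_derive (t : R^o) 1 (fun s : R^o => xi (Ad (gexp (s *: x)) y) : R^o)
      (xi (br g x (Ad (gexp (t *: x)) y)))
}.

(** * Geometry of the adjoint orbit *)

Section Orbit.
Variables (R : realType) (g : lie_algebra R).
Variables (G : preTopologicalGroupType) (LG : lie_group g G).

Definition stabilizer (v : g) : set G := [set a | Ad LG a v = v].

(* The Lie algebra of the stabilizer V of v. *)
Definition lie_stab (v : g) : {vspace g} := lker (br g v).

Definition orbit_tangent (v : g) : {vspace g} := killing_orth (lie_stab v).

Definition pr_tangent (v : g) : 'End(g) :=
  daddv_pi (orbit_tangent v) (lie_stab v).

Definition pr_stab (v : g) : 'End(g) :=
  daddv_pi (lie_stab v) (orbit_tangent v).

Definition kks (v x y : g) : R := killing v (br g x y).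

(* Invariant tensors and connections on the reductive homogeneous space G/V are
   given by their values on m = T_e(G/V).  Brackets of vector fields become
   m-components of brackets in g (Kobayashi-Nomizu II, Chapter X), whence the
   Nijenhuis tensor of an invariant almost complex structure J. *)
Definition nijenhuis (v : g) (J : 'End(g)) (x y : g) : g :=
  let pm := pr_tangent v in
  4^-1 *: (pm (br g (J x) (J y)) - J (pm (br g (J x) y))
           - J (pm (br g x (J y))) - pm (br g x y)).

(* By Nomizu's theorem, G-invariant affine connections on G/V correspond to the
   Ad(V)-equivariant bilinear maps L : m * m -> m (only the values of L on m
   are meaningful), with the following torsion and curvature, and an invariant
   tensor is parallel when L x annihilates it for every x in m. *)
Definition invariant_connection (v : g) (L : 'Hom(g, 'End(g))) : Prop :=
  let m := orbit_tangent v in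
  (forall x y, x \in m -> y \in m -> L x y \in m) /\
  (forall a x y, stabilizer v a -> x \in m -> y \in m ->
     L (Ad LG a x) (Ad LG a y) = Ad LG a (L x y)).

Definition torsion (v : g) (L : 'Hom(g, 'End(g))) (x y : g) : g :=
  L x y - L y x - pr_tangent v (br g x y).

Definition curvature (v : g) (L : 'Hom(g, 'End(g))) (x y w : g) : g :=
  L x (L y w) - L y (L x w) - L (pr_tangent v (br g x y)) w
  - br g (pr_stab v (br g x y)) w.

(* The Chern connection is unique, hence G-invariant. *)
Definition chern_connection (v : g) (J : 'End(g)) (L : 'Hom(g, 'End(g))) :
    Prop :=
  let m := orbit_tangent v in
  [/\ invariant_connection v L,
      forall x y z, x \in m -> y \in m -> z \in m ->
        kks v (L x y) z + kks v y (L x z) = 0,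
      forall x y, x \in m -> y \in m -> L x (J y) = J (L x y)
    & forall x y, x \in m -> y \in m -> torsion v L x y = nijenhuis v J x y].

Definition chern_ricci (v : g) (J : 'End(g)) (L : 'Hom(g, 'End(g)))
    (x y : g) : R :=
  trace_on (orbit_tangent v) (fun w => J (curvature v L x y w)).

Variables (p h0 : {vspace g}) (l : nat) (gamma : 'I_l -> weight R h0).
Implicit Type phi : weight R h0.

(* This determines J on m = T_e(G/V), the only place where it is used. *)
Definition canonical_acs phi (J : 'End(g)) : Prop :=
  forall al, positive_root gamma al -> wform phi al != 0 ->
  forall x, mspace al x ->
    J x = (eps p al / wform phi al) *: br g (ivec phi) x.

Definition integrable_weight phi : Prop :=
  exists2 J, canonical_acs phi J &
  forall x y, x \in orbit_tangent (ivec phi) ->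
    y \in orbit_tangent (ivec phi) -> nijenhuis (ivec phi) J x y = 0.

Definition special_weight phi : Prop :=
  exists J L, [/\ canonical_acs phi J, chern_connection (ivec phi) J L &
  exists lam : R, forall x y, x \in orbit_tangent (ivec phi) ->
    y \in orbit_tangent (ivec phi) ->
    chern_ricci (ivec phi) J L x y = lam * kks (ivec phi) x y].

End Orbit.

(* Main.v *)
Require Import Defs.
From HB Require Import structures.
From mathcomp Require Import all_boot all_order all_fingroup all_algebra.
From mathcomp Require Import all_classical all_reals all_analysis.
From mathcomp Require Import complex ring lra zify.

Set Implicit Arguments.
Unset Strict Implicit.
Unset Printing Implicit Defensive.

Import Order.TTheory GRing.Theory Num.Theory.
Import numFieldNormedType.Exports.

Local Open Scope ring_scope.

(** The compactness, integrability and special conditions are statements about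
    the positive roots, in which the painted simple root [gamma_s] has a
    privileged role.

    Compactness of the stabilizer of [v] forces that no noncompact root is
    orthogonal to [phi]: along the one-parameter group generated by an element of
    [p] commuting with [v], norms of vectors are convex functions, and
    some are not constant, hence unbounded ([compact_stabilizer_root]). Integrability then says that vectors
    of two positive noncompact root spaces commute, because their bracket would
    be of type (1,0) as a bracket of vectors of type (1,0), but of type (0,1) as a
    vector in a positive compact root space ([integrable_noncompact_commute]).
    Stripping simple roots one by one from a positive root shows that [gamma_s]
    has coefficient at most one in every root, and coefficient zero in compact
    ones ([painted_coef]). In the classical diagrams the nodes with this
    property are the listed ones, up to the symmetry of the fork in type D: for
    any other node there is an explicit chain of roots that leads to a
    coefficient two ([coef_le1_listed]).

    Being special gives an equation [- lam * (phi, be) = (P - Q, be)] for the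
    positive roots [be] not orthogonal to [phi], where [P] is the sum of the
    noncompact roots among them and [Q] that of the compact ones, counted with
    the real dimension of the root spaces ([special_root_equation]). It is
    obtained by evaluating the Chern-Ricci form on the real and imaginary parts
    of root vectors, where only the isotropy term of the curvature contributes
    to the trace. The sum [Q] involves only unpainted simple roots, and against
    these the two sums have controlled signs: [(P, gamma_i) <= 0], and
    [(Q, gamma_i) > 0] unless [(phi, gamma_i) = 0]. Pairing the equation with [P]
    gives [lam < 0], and pairing it with an unpainted simple root that is not
    orthogonal to [phi] gives [lam > 0]. Hence [phi] is orthogonal to every
    unpainted simple root ([unpainted_orthogonal]), so that it is a multiple of
    the fundamental weight of the painted node.

    The structure theory is elementary. The complexification is treated as a
    real vector space with the positive definite form [cx_form]; there [i h0]
    acts by commuting symmetric operators, which have an orthonormal basis of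
    joint eigenvectors ([weight_basis]). For a root vector [e] the adjoint of
    [ad e] is [ad e'] with [e' = cx_adjoint e], and [[e, e']] is a multiple of the
    dual of the root. So for a vector [z] of weight [be],
    [(be, al) |e|^2 |z|^2 = |[e', z]|^2 - |[e, z]|^2] ([adj_root_string]).
    One-dimensionality of root spaces, the existence of sums of roots, and, after
    summation over sets of weights, the signs above ([flux]) are consequences of
    this identity. *)

(** * Traces *)
Section Traces.
Variables (R : realType) (V : vectType R).
Implicit Types (U : {vspace V}) (f g : 'End(V)).

Lemma eq_trace_on U (f g : V -> V) :
  {in U, f =1 g} -> trace_on U f = trace_on U g.
Proof.
move=> fg; apply: eq_bigr => i _; rewrite fg //.
by apply: vbasis_mem; rewrite mem_nth ?size_tuple.
Qed.

Lemma trace_onD U (f g : V -> V) :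
  trace_on U (fun x => f x + g x) = trace_on U f + trace_on U g.
Proof. by rewrite /trace_on -big_split; apply: eq_bigr => i _; rewrite linearD. Qed.

Lemma trace_onZ U a (f : V -> V) :
  trace_on U (fun x => a *: f x) = a * trace_on U f.
Proof. by rewrite /trace_on mulr_sumr; apply: eq_bigr => i _; rewrite linearZ. Qed.

Lemma trace_onN U (f : V -> V) :
  trace_on U (fun x => - f x) = - trace_on U f.
Proof. by rewrite /trace_on -sumrN; apply: eq_bigr => i _; rewrite linearN. Qed.

Lemma trace_onB U (f g : V -> V) :
  trace_on U (fun x => f x - g x) = trace_on U f - trace_on U g.
Proof. by rewrite trace_onD trace_onN. Qed.

Lemma trace_on_comp U f g :
  (forall x, x \in U -> f x \in U) -> (forall x, x \in U -> g x \in U) ->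
  trace_on U (fun x => f (g x)) = trace_on U (fun x => g (f x)).
Proof.
move=> fU gU.
have mU (i : 'I_(\dim U)) : (vbasis U)`_i \in U.
  by apply: vbasis_mem; rewrite mem_nth ?size_tuple.
have E (p q : 'End(V)) : (forall x, x \in U -> q x \in U) ->
  trace_on U (fun x => p (q x)) = \sum_(i < \dim U) \sum_(j < \dim U)
     coord (vbasis U) j (q (vbasis U)`_i) * coord (vbasis U) i (p (vbasis U)`_j).
  move=> qU; apply: eq_bigr => i _.
  rewrite [in LHS](coord_vbasis (qU _ (mU i))) !linear_sum; apply: eq_bigr => j _.
  by rewrite !linearZ.
rewrite (E f g) // (E g f) // exchange_big; apply: eq_bigr => i _.
by apply: eq_bigr => j _; rewrite mulrC.
Qed.

(** Expanding each of two bases in the other one shows that the trace does not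
    depend on the basis; this lets it be read off from root vectors. *)
Lemma trace_on_basis U n (X : n.-tuple V) f :
  basis_of U X -> (forall x, x \in U -> f x \in U) ->
  trace_on U f = \sum_(i < n) coord X i (f X`_i).
Proof.
move=> bX fU.
have mX (i : 'I_n) : X`_i \in U by apply: (basis_mem bX); rewrite mem_nth ?size_tuple.
have mU (i : 'I_(\dim U)) : (vbasis U)`_i \in U.
  by apply: vbasis_mem; rewrite mem_nth ?size_tuple.
transitivity (\sum_(i < \dim U) \sum_(j < n)
     coord X j (vbasis U)`_i * coord (vbasis U) i (f X`_j)).
  apply: eq_bigr => i _; rewrite [in LHS](coord_basis bX (mU i)) !linear_sum.
  by apply: eq_bigr => j _; rewrite !linearZ.
rewrite exchange_big; apply: eq_bigr => j _.
rewrite [in RHS](coord_vbasis (fU _ (mX j))) linear_sum; apply: eq_bigr => i _.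
by rewrite linearZ /= mulrC.
Qed.

Lemma trace_on_diag U n (X : n.-tuple V) f (c : 'I_n -> R) :
  basis_of U X -> (forall i : 'I_n, f X`_i = c i *: X`_i) ->
  trace_on U f = \sum_(i < n) c i.
Proof.
move=> bX fX.
rewrite (trace_on_basis bX).
  apply: eq_bigr => i _; rewrite fX linearZ /= coord_free ?(basis_free bX) //.
  by rewrite eqxx mulr1.
move=> x xU; rewrite (coord_basis bX xU) linear_sum; apply: memv_suml => i _.
rewrite linearZ /= fX !memvZ // (basis_mem bX) // mem_nth ?size_tuple //.
Qed.

End Traces.

(** * Commuting symmetric operators *)
Section Spectral.
Variables (R : realType) (V : vectType R).

Definition inner_product (H : V -> V -> R) : Prop :=
  [/\ forall a x y z, H (a *: x + y) z = a * H x z + H y z,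
      forall x y, H x y = H y x
    & forall x, x != 0 -> 0 < H x x].

Variable H : V -> V -> R.
Hypothesis HH : inner_product H.

Lemma ipC x y : H x y = H y x. Proof. by case: HH. Qed.
Lemma ip_gt0 x : x != 0 -> 0 < H x x. Proof. by case: HH => _ _; apply. Qed.
Lemma ipDl x y z : H (x + y) z = H x z + H y z.
Proof. by case: HH => L _ _; rewrite -[x]scale1r L mul1r scale1r. Qed.
Lemma ip0l z : H 0 z = 0.
Proof. by apply: (@addrI _ (H 0 z)); rewrite -ipDl !addr0. Qed.
Lemma ipZl a x z : H (a *: x) z = a * H x z.
Proof. by case: HH => L _ _; rewrite -[a *: x]addr0 L ip0l addr0. Qed.
Lemma ipNl x z : H (- x) z = - H x z.
Proof. by rewrite -scaleN1r ipZl mulN1r. Qed.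
Lemma ipBl x y z : H (x - y) z = H x z - H y z.
Proof. by rewrite ipDl ipNl. Qed.
Lemma ipDr x y z : H z (x + y) = H z x + H z y.
Proof. by rewrite ipC ipDl !(ipC z). Qed.
Lemma ip0r z : H z 0 = 0. Proof. by rewrite ipC ip0l. Qed.
Lemma ipZr a x z : H z (a *: x) = a * H z x.
Proof. by rewrite ipC ipZl (ipC z). Qed.
Lemma ipNr x z : H z (- x) = - H z x. Proof. by rewrite ipC ipNl (ipC z). Qed.
Lemma ipBr x y z : H z (x - y) = H z x - H z y.
Proof. by rewrite ipDr ipNr. Qed.
Lemma ip_suml I (r : seq I) (P : pred I) F z :
  H (\sum_(i <- r | P i) F i) z = \sum_(i <- r | P i) H (F i) z.
Proof. by apply: (big_morph (H^~ z)) => [x y|]; rewrite ?ip0l ?ipDl. Qed.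
Lemma ip_sumr I (r : seq I) (P : pred I) F z :
  H z (\sum_(i <- r | P i) F i) = \sum_(i <- r | P i) H z (F i).
Proof. by rewrite ipC ip_suml; apply: eq_bigr => i _; rewrite ipC. Qed.
Lemma ip_eq0 x : (H x x == 0) = (x == 0).
Proof.
apply/eqP/eqP => [|->]; last by rewrite ip0l.
by move=> h; apply/eqP; apply/negPn/negP => /ip_gt0; rewrite h ltxx.
Qed.
Lemma ip_ge0 x : 0 <= H x x.
Proof. by have [->|/ip_gt0/ltW//] := eqVneq x 0; rewrite ip0l. Qed.
Lemma ip_ext x y : (forall z, H x z = H y z) -> x = y.
Proof.
by move=> h; apply/eqP; rewrite -subr_eq0 -ip_eq0 ipBl h subrr.
Qed.
Definition ip_form x : 'Hom(V, R^o) := linfun (H x : V -> R^o).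
Lemma ip_formE x y : ip_form x y = H x y.
Proof.
have L : linear (H x : V -> R^o) by move=> a u v; rewrite ipDr ipZr.
pose M := GRing.isLinear.Build _ _ _ _ (H x : V -> R^o) L.
pose f : {linear V -> R^o} := HB.pack (H x : V -> R^o) M.
by rewrite /ip_form -[H x]/(f : V -> R^o) lfunE.
Qed.

Definition symmetric_op (T : 'End(V)) := forall x y, H (T x) y = H x (T y).

(** The characteristic polynomial has a complex root [a]. If [u + i w] is a
    complex eigenvector, comparing [(T u, w)] with [(u, T w)] gives
    [Im a * (|u|^2 + |w|^2) = 0], so that [a] is real and [u] or [w] is a real
    eigenvector. *)
Lemma symmetric_eigenvector (U : {vspace V}) (T : 'End(V)) :
  U != 0%VS -> (forall x, x \in U -> T x \in U) -> symmetric_op T ->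
  exists a x, [/\ x \in U, x != 0 & T x = a *: x].
Proof.
move=> U0 TU sT.
have mU (i : 'I_(\dim U)) : (vbasis U)`_i \in U.
  by apply: vbasis_mem; rewrite mem_nth ?size_tuple.
have fU := basis_free (vbasisP U).
pose A : 'M[R]_(\dim U) := \matrix_(i, j) coord (vbasis U) j (T (vbasis U)`_i).
pose vec (v : 'rV[R]_(\dim U)) : V := \sum_i v 0 i *: (vbasis U)`_i.
have vecU v : vec v \in U by apply: memv_suml => i _; rewrite memvZ.
have vecZ a v : vec (a *: v) = a *: vec v.
  by rewrite /vec scaler_sumr; apply: eq_bigr => i _; rewrite mxE scalerA.
have vecD v w : vec (v + w) = vec v + vec w.
  by rewrite /vec -big_split; apply: eq_bigr => i _; rewrite mxE scalerDl.
have vec0 v : vec v = 0 -> v = 0.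
  move=> h; apply/rowP => i; rewrite mxE.
  by have := coord_sum_free (v 0) i fU; rewrite -/(vec v) h linear0.
have Tvec v : T (vec v) = vec (v *m A).
  rewrite /vec linear_sum; under eq_bigr => i _.
    rewrite linearZ /= (coord_vbasis (TU _ (mU i))) scaler_sumr; over.
  rewrite exchange_big; apply: eq_bigr => j _.
  rewrite mxE scaler_suml; apply: eq_bigr => i _.
  by rewrite scalerA mxE.
have [a /eigenvalueP[v vA v0]] :
    exists a, eigenvalue (map_mx (real_complex R) A) a.
  have dU : (0 < \dim U)%N by rewrite lt0n dimv_eq0.
  have /closed_rootP[a ra] :
      size (char_poly (map_mx (real_complex R) A)) != 1%N.
    by rewrite size_char_poly; case: (\dim U) dU.
  by exists a; rewrite eigenvalue_root_char.
pose u := map_mx (@complex.Re R) v; pose w := map_mx (@complex.Im R) v.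
have uw : u = 0 -> w = 0 -> v = 0.
  move=> /rowP u0 /rowP w0; apply/rowP => i; move: (u0 i) (w0 i); rewrite !mxE.
  by case: (v 0 i) => r s /= -> ->.
have [Eu Ew] : u *m A = complex.Re a *: u - complex.Im a *: w /\
     w *m A = complex.Re a *: w + complex.Im a *: u.
  move/rowP: vA => vA; split; apply/rowP => i; move: (vA i); rewrite !mxE.
    move=> /(congr1 (@complex.Re R)); rewrite (raddf_sum (@complex.Re R)) => E.
    transitivity (complex.Re (a * v 0 i)).
      by rewrite -E; apply: eq_bigr => j _; rewrite !mxE; case: (v 0 j) => r s; simpc.
    by case: (a) (v 0 i) => r s [r' s'].
  move=> /(congr1 (@complex.Im R)); rewrite (raddf_sum (@complex.Im R)) => E.
  transitivity (complex.Im (a * v 0 i)).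
    by rewrite -E; apply: eq_bigr => j _; rewrite !mxE; case: (v 0 j) => r s; simpc.
  by case: (a) (v 0 i) => r s [r' s'] /=; rewrite mulrC addrC [s * _]mulrC mulrC.
have Im0 : complex.Im a = 0.
  have := sT (vec u) (vec w).
  rewrite !Tvec Eu Ew -scaleNr !vecD !vecZ !(ipDl, ipDr, ipZl, ipZr).
  move=> /addrI /eqP; rewrite mulNr eq_sym -subr_eq0 opprK -mulrDr mulf_eq0.
  case/orP => [/eqP //|/eqP h].
  have h1 := ip_ge0 (vec u); have h2 := ip_ge0 (vec w).
  have /andP[/eqP k1 /eqP k2] : (H (vec u) (vec u) == 0) && (H (vec w) (vec w) == 0).
    by rewrite -paddr_eq0 // h.
  case/eqP: v0; apply: uw; apply: vec0; apply/eqP; rewrite -ip_eq0 ?k1 ?k2 //.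
rewrite Im0 !scale0r subr0 addr0 in Eu Ew.
(* The real part may vanish, but then the imaginary part does not. *)
have [u0|u0] := eqVneq u 0; last first.
  exists (complex.Re a), (vec u); split=> //; last by rewrite Tvec Eu vecZ.
  by apply/eqP => /vec0 /eqP; apply/negP.
exists (complex.Re a), (vec w); split=> //; last by rewrite Tvec Ew vecZ.
by apply/eqP => /vec0 w0; case/eqP: v0; apply: uw.
Qed.

Variables (I : Type) (T : I -> 'End(V)).
Hypothesis sT : forall i, symmetric_op (T i).
Hypothesis cT : forall i j x, T i (T j x) = T j (T i x).

(** A stable subspace on which some operator is not scalar contains a proper
    stable subspace, an eigenspace of that operator; a minimal one therefore
    consists of joint eigenvectors. *)
Lemma joint_eigenvector (U : {vspace V}) :
  U != 0%VS -> (forall i x, x \in U -> T i x \in U) ->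
  exists x, [/\ x \in U, x != 0 & forall i, exists a, T i x = a *: x].
Proof.
have [n] := ubnP (\dim U); elim: n U => // n IH U /ltnSE dU U0 TU.
have [h|] := pselect (forall i, exists a, forall x, x \in U -> T i x = a *: x).
  exists (vpick U); split; rewrite ?memv_pick ?vpick0 // => i.
  by have [a ha] := h i; exists a; apply: ha; rewrite memv_pick.
move=> /existsNP[i /forallNP nsc].
have [a [x [xU x0 Tx]]] := symmetric_eigenvector U0 (TU i) (@sT i).
pose W := (U :&: lker (T i - a *: \1%VF))%VS.
have mW y : (y \in W) = (y \in U) && (T i y == a *: y).
  by rewrite memv_cap memv_ker add_lfunE opp_lfunE scale_lfunE id_lfunE subr_eq0.
have [||j y|y [yW y0 h]] := IH W.
- apply: leq_trans dU; rewrite ltnNge; apply/negP => d.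
  have EW : W = U by apply/eqP; rewrite eqEdim capvSl.
  by apply: (nsc a) => y; rewrite -EW mW => /andP[_ /eqP].
- by apply/negP => /eqP W0; move: (mW x); rewrite W0 memv0 (negPf x0) xU Tx eqxx.
- rewrite !mW => /andP[yU /eqP yT]; rewrite TU //=.
  by rewrite cT yT linearZ.
by exists y; split=> //; move: yW; rewrite mW => /andP[].
Qed.

(** The orthogonal complement of a joint eigenvector is stable, by symmetry. *)
Lemma joint_eigenbasis (U : {vspace V}) :
  (forall i x, x \in U -> T i x \in U) ->
  exists s : seq V,
   [/\ forall x, x \in s -> forall i, exists a, T i x = a *: x,
       all (fun x => H x x == 1) s, pairwise (fun x y => H x y == 0) s,
       {subset s <= U}
     & forall x, x \in U -> x = \sum_(z <- s) H x z *: z].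
Proof.
have [n] := ubnP (\dim U); elim: n U => // n IH U /ltnSE dU TU.
have [U0|U0] := eqVneq U 0%VS.
  exists [::]; split=> // x; rewrite U0 memv0 big_nil => /eqP //.
have [x1 [x1U x10 Tx1]] := joint_eigenvector U0 TU.
(* Split off a unit joint eigenvector. *)
pose x := (Num.sqrt (H x1 x1))^-1 *: x1.
have xU : x \in U by rewrite memvZ.
have Tx i : exists a, T i x = a *: x.
  by have [a E] := Tx1 i; exists a; rewrite linearZ /= E !scalerA mulrC.
have xx : H x x = 1.
  rewrite ipZl ipZr mulrA -expr2 exprVn sqr_sqrtr ?ip_ge0 // mulVf //.
  by rewrite ip_eq0.
pose W := (U :&: lker (ip_form x))%VS.
have mW y : (y \in W) = (y \in U) && (H x y == 0).
  by rewrite memv_cap memv_ker ip_formE.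
have [||s [s1 s2 s3 s4 s5]] := IH W.
- apply: leq_trans dU; rewrite ltnNge; apply/negP => d.
  have EW : W = U by apply/eqP; rewrite eqEdim capvSl.
  by move: xU; rewrite -EW mW xx oner_eq0 andbF.
- move=> i y; rewrite !mW => /andP[yU /eqP yx]; rewrite TU //=.
  by have [a E] := Tx i; rewrite -sT E ipZl yx mulr0.
have xs y : y \in s -> H x y = 0 by move=> /s4; rewrite mW => /andP[_ /eqP].
exists (x :: s); split=> [y||||y yU].
- by rewrite inE => /predU1P[-> //|/s1].
- by rewrite /= xx eqxx.
- by rewrite /= s3 andbT; apply/allP => y /xs /eqP.
- by move=> y; rewrite inE => /predU1P[-> //|/s4]; rewrite mW => /andP[].
rewrite big_cons -[LHS](subrK (H y x *: x)) addrC; congr (_ + _).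
rewrite {1}(s5 (y - H y x *: x)).
  rewrite big_seq [RHS]big_seq; apply: eq_bigr => z zs.
  by rewrite ipBl ipZl (xs z) // mulr0 subr0.
by rewrite mW memvB ?memvZ //= ipBr ipZr xx mulr1 (ipC y) subrr.
Qed.

Lemma orthonormal_joint_eigenbasis :
  exists n (z : 'I_n -> V) (w : 'I_n -> I -> R),
   [/\ forall k i, T i (z k) = w k i *: z k,
       forall k m, H (z k) (z m) = (k == m)%:R
     & forall x, x = \sum_k H x (z k) *: z k].
Proof.
have [|s [s1 s2 s3 _ s5]] := @joint_eigenbasis fullv; first by move=> *; apply: memvf.
have Ew (k : 'I_(size s)) : exists w : I -> R, forall i, T i s`_k = w i *: s`_k.
  have [|w hw] := @choice _ _ (fun i a => T i s`_k = a *: s`_k); last by exists w.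
  by move=> i; apply: s1; rewrite mem_nth.
have [w hw] := choice Ew.
exists (size s), (fun k => s`_k), w; split=> // [k m|x].
  have [-> {k}|] := eqVneq k m; first by move/allP: s2 => /(_ _ (mem_nth 0 (ltn_ord m)))/eqP.
  move/(pairwiseP 0): s3 => s3 km; have := km; rewrite -val_eqE neq_ltn.
  case/orP => lt; last rewrite ipC.
    by apply/eqP/s3; rewrite ?inE ?ltn_ord.
  by apply/eqP/s3; rewrite ?inE ?ltn_ord.
by rewrite {1}(s5 x (memvf _)) (big_nth 0) big_mkord.
Qed.

End Spectral.

(** * Lie algebras and their complexification *)
Section Bracket.
Variables (R : realType) (g : lie_algebra R).
Implicit Types (x y z : g) (e f w : (g * g)%type).

Lemma brDl x y z : br g (x + y) z = br g x z + br g y z.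
Proof. by rewrite linearD /= add_lfunE. Qed.
Lemma brZl a x z : br g (a *: x) z = a *: br g x z.
Proof. by rewrite linearZ /= scale_lfunE. Qed.
Lemma brNl x z : br g (- x) z = - br g x z.
Proof. by rewrite -scaleN1r brZl scaleN1r. Qed.
Lemma br0l z : br g 0 z = 0.
Proof. by have := brZl 0 0 z; rewrite !scale0r. Qed.
Lemma brC x y : br g x y = - br g y x.
Proof.
have := br_alt (x + y); rewrite brDl !linearD /= !br_alt add0r addr0 => /eqP.
by rewrite addr_eq0 => /eqP.
Qed.
Lemma brDr x y z : br g z (x + y) = br g z x + br g z y.
Proof. exact: linearD. Qed.
Lemma brNr x z : br g z (- x) = - br g z x.
Proof. exact: linearN. Qed.
Lemma br0r z : br g z 0 = 0. Proof. exact: linear0. Qed.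

Lemma br_br x y z : br g (br g x y) z = br g x (br g y z) - br g y (br g x z).
Proof.
have /eqP := br_jacobi x y z; rewrite -addrA addr_eq0 => /eqP ->.
by rewrite opprD (brC z (br g x y)) opprK (brC z x) brNr opprK addrAC subrr add0r.
Qed.

Lemma killingC x y : killing x y = killing y x.
Proof. by apply: trace_on_comp => u _; rewrite memvf. Qed.
Lemma killingDl x y z : killing (x + y) z = killing x z + killing y z.
Proof.
rewrite /killing -trace_onD; apply: eq_trace_on => u _; exact: brDl.
Qed.
Lemma killingZl a x z : killing (a *: x) z = a * killing x z.
Proof. rewrite /killing -trace_onZ; apply: eq_trace_on => u _; exact: brZl. Qed.
Lemma killingNl x z : killing (- x) z = - killing x z.
Proof. by rewrite -scaleN1r killingZl mulN1r. Qed.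
Lemma killing0l z : killing 0 z = 0.
Proof. by have := killingZl 0 0 z; rewrite scale0r mul0r. Qed.
Lemma killingDr x y z : killing z (x + y) = killing z x + killing z y.
Proof. by rewrite !(killingC z) killingDl. Qed.
Lemma killingZr a x z : killing z (a *: x) = a * killing z x.
Proof. by rewrite !(killingC z) killingZl. Qed.
Lemma killingNr x z : killing z (- x) = - killing z x.
Proof. by rewrite !(killingC z) killingNl. Qed.
Lemma killing_br x y z : killing (br g x y) z = killing x (br g y z).
Proof.
rewrite /killing.
transitivity (trace_on fullv (fun u => br g x (br g y (br g z u)))
   - trace_on fullv (fun u => br g y (br g x (br g z u)))).
  by rewrite -trace_onB; apply: eq_trace_on => u _; rewrite br_br.
transitivity (trace_on fullv (fun u => br g x (br g y (br g z u)))
   - trace_on fullv (fun u => br g x (br g z (br g y u)))).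
  congr (_ - _).
  have := @trace_on_comp R g fullv (br g y) (br g x \o br g z)%VF.
  rewrite (@eq_trace_on _ _ _ _ (fun u => br g y (br g x (br g z u)))); last first.
    by move=> u _; rewrite comp_lfunE.
  move=> ->; try by move=> u _; apply: memvf.
  by apply: eq_trace_on => u _; rewrite comp_lfunE.
by rewrite -trace_onB; apply: eq_trace_on => u _; rewrite br_br linearB.
Qed.

Lemma cbrDl e f w : cbr (e + f) w = cbr e w + cbr f w.
Proof.
by rewrite /cbr /= !brDl; congr (_, _); rewrite /= ?opprD addrACA.
Qed.
Lemma cbrZl a e w : cbr (a *: e) w = a *: cbr e w.
Proof. by rewrite /cbr /= !brZl -scalerBr -scalerDr. Qed.
Lemma cbrC e f : cbr e f = - cbr f e.
Proof.
rewrite /cbr /=; congr (_, _).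
  by rewrite (brC e.1) (brC e.2) /= opprD.
by rewrite (brC e.1) (brC e.2) -opprD addrC.
Qed.
Lemma cbrDr e f w : cbr w (e + f) = cbr w e + cbr w f.
Proof. by rewrite !(cbrC w) cbrDl opprD. Qed.
Lemma cbrZr a e w : cbr w (a *: e) = a *: cbr w e.
Proof. by rewrite !(cbrC w) cbrZl scalerN. Qed.
Lemma cbrNr e w : cbr w (- e) = - cbr w e.
Proof. by rewrite -scaleN1r cbrZr scaleN1r. Qed.
Lemma cbr0l w : cbr 0 w = 0.
Proof. by have := cbrZl 0 0 w; rewrite !scale0r. Qed.
(** Multiplication by i on the complexification. *)
Definition imul e : (g * g)%type := (- e.2, e.1).

Lemma cbr_iml e w : cbr (imul e) w = imul (cbr e w).
Proof. by congr (_, _); rewrite /= !brNl ?opprD addrC. Qed.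
Lemma cbr_imr e w : cbr e (imul w) = imul (cbr e w).
Proof. by rewrite (cbrC e) cbr_iml (cbrC w); congr (_, _); rewrite /= !opprK. Qed.
Lemma imulN e : imul (- e) = - imul e. Proof. by []. Qed.
Lemma imulZ a e : imul (a *: e) = a *: imul e.
Proof. by congr (_, _); rewrite /= scalerN. Qed.
Lemma imulK e : imul (imul e) = - e. Proof. by []. Qed.

End Bracket.

(** * Cartan decompositions *)
Section Cartan.
Variables (R : realType) (g : lie_algebra R) (k p : {vspace g}).
Hypothesis HC : cartan_decomposition k p.
Implicit Types (x y z : g) (e f w : (g * g)%type).

Definition cartan_involution : 'End(g) := daddv_pi k p - daddv_pi p k.
Local Notation theta := cartan_involution.

Let cap0 : (k :&: p)%VS = 0%VS. Proof. by case: HC. Qed.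
Let cap0' : (p :&: k)%VS = 0%VS. Proof. by rewrite capvC. Qed.

Lemma daddv_pi_0 (U W : {vspace g}) x :
  (U :&: W)%VS = 0%VS -> x \in W -> daddv_pi U W x = 0.
Proof.
move=> UW xW; have WU : (W :&: U)%VS = 0%VS by rewrite capvC.
have := @daddv_pi_add _ _ U W x UW; rewrite (subvP (addvSr U W) _ xW).
by move=> /(_ isT); rewrite (daddv_pi_id WU xW) => /(canRL (addrK _)); rewrite subrr.
Qed.

Lemma theta_k x : x \in k -> theta x = x.
Proof.
by move=> xk; rewrite add_lfunE opp_lfunE daddv_pi_id // daddv_pi_0 // subr0.
Qed.
Lemma theta_p x : x \in p -> theta x = - x.
Proof.
by move=> xp; rewrite add_lfunE opp_lfunE daddv_pi_0 // daddv_pi_id // sub0r.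
Qed.
Lemma cartan_split x : exists y z, [/\ y \in k, z \in p & x = y + z].
Proof.
have : x \in (k + p)%VS by case: HC => ->; rewrite memvf.
by case/memv_addP => y yk [z zp ->]; exists y, z.
Qed.
Lemma thetaK x : theta (theta x) = x.
Proof.
have [y [z [yk zp ->]]] := cartan_split x.
by rewrite !linearD /= (theta_k yk) (theta_p zp) linearN /= theta_k // theta_p // opprK.
Qed.
Lemma in_k x : theta x = x -> x \in k.
Proof.
have [y [z [yk zp ->]]] := cartan_split x; rewrite linearD /= theta_k // theta_p //.
move=> /addrI h; suff -> : z = 0 by rewrite addr0.
have /eqP : z + z = 0 by rewrite -{1}h addNr.
by rewrite -mulr2n -scaler_nat scaler_eq0 pnatr_eq0 => /eqP.
Qed.
Lemma in_p x : theta x = - x -> x \in p.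
Proof.
have [y [z [yk zp ->]]] := cartan_split x; rewrite linearD /= theta_k // theta_p //.
rewrite opprD => /addIr h; suff -> : y = 0 by rewrite add0r.
have /eqP : y + y = 0 by rewrite {1}h addNr.
by rewrite -mulr2n -scaler_nat scaler_eq0 pnatr_eq0 => /eqP.
Qed.
Lemma theta_br x y : theta (br g x y) = br g (theta x) (theta y).
Proof.
case: HC => _ _ [kk kp pp] _ _.
have [xk [xp [xk' xp' ->]]] := cartan_split x.
have [yk [yp [yk' yp' ->]]] := cartan_split y.
have pk : br g xp yk \in p by rewrite brC memvN kp.
have -> : theta (xk + xp) = xk - xp by rewrite linearD /= theta_k // theta_p.
have -> : theta (yk + yp) = yk - yp by rewrite linearD /= theta_k // theta_p.
rewrite !(brDl, brDr) !linearD /= (theta_k (kk _ _ xk' yk')).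
rewrite (theta_p (kp _ _ xk' yp')) (theta_p pk) (theta_k (pp _ _ xp' yp')).
by rewrite !(brNl, brNr) opprK.
Qed.
(** The Cartan involution is an automorphism, and conjugation by an
    automorphism does not change traces. *)
Lemma killing_theta x y : killing (theta x) (theta y) = killing x y.
Proof.
rewrite /killing.
transitivity (trace_on fullv
    (fun u => theta ((br g x \o br g y \o theta)%VF u))).
  by apply: eq_trace_on => u _; rewrite !comp_lfunE !theta_br thetaK.
rewrite trace_on_comp; try by move=> *; apply: memvf.
by apply: eq_trace_on => u _; rewrite !comp_lfunE thetaK.
Qed.
Lemma killing_thetaC x y : killing (theta x) y = killing x (theta y).
Proof. by rewrite -killing_theta thetaK. Qed.

Definition cartan_form x y : R := - killing x (theta y).
Local Notation Bth := cartan_form.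

Lemma killing_kp x y : x \in k -> y \in p -> killing x y = 0.
Proof.
move=> xk yp; have := killing_theta x y; rewrite theta_k // theta_p // killingNr.
lra.
Qed.

Lemma Bth_inner : inner_product Bth.
Proof.
split=> [a x y z|x y|x x0].
- by rewrite /cartan_form killingDl killingZl opprD mulrN.
- by rewrite /cartan_form -killing_thetaC killingC.
case: HC => _ _ _ kneg ppos.
have [y [z [yk zp E]]] := cartan_split x.
have -> : Bth x x = - killing y y + killing z z.
  rewrite /cartan_form E linearD /= theta_k // theta_p // !(killingDl, killingDr, killingNr).
  by rewrite (killingC z y) (killing_kp yk zp); ring.
have hy : 0 <= - killing y y.
  have [->|y0] := eqVneq y 0; first by rewrite killing0l oppr0.
  by rewrite oppr_ge0 ltW ?kneg.
have hz : 0 <= killing z z.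
  have [->|z0] := eqVneq z 0; first by rewrite killing0l.
  by rewrite ltW ?ppos.
have [y0|y0] := eqVneq y 0; last by have := kneg y yk y0; lra.
have z0 : z != 0 by apply: contraNneq x0 => z0; rewrite E y0 z0 addr0.
have := ppos z zp z0; lra.
Qed.

Lemma Bth_br x y z : Bth (br g x y) z = - Bth y (br g (theta x) z).
Proof.
by rewrite /cartan_form (brC x) killingNl killing_br theta_br thetaK.
Qed.
Lemma Bth_theta x y : Bth (theta x) (theta y) = Bth x y.
Proof. by rewrite /cartan_form killing_theta. Qed.

Definition cx_form e f : R := Bth e.1 f.1 + Bth e.2 f.2.
Local Notation Hc := cx_form.

Lemma Hc_inner : inner_product Hc.
Proof.
have B := Bth_inner; split=> [a x y z|x y|[x y]].
- by rewrite /cx_form /= !(ipDl B, ipZl B); ring.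
- by rewrite /cx_form (ipC B x.1) (ipC B x.2).
rewrite /cx_form /= => xy.
have := ip_ge0 B x; have := ip_ge0 B y.
have [x0|/(ip_gt0 B)] := eqVneq x 0; last lra.
have /(ip_gt0 B) : y != 0 by apply: contraNneq xy => ->; rewrite x0.
by lra.
Qed.

(** Minus the conjugate of [e] with respect to the compact real form
    [k + i p]: its adjoint action is adjoint to that of [e] for [cx_form]. *)
Definition cx_adjoint e : (g * g)%type := (- theta e.1, theta e.2).
Local Notation adj := cx_adjoint.

Lemma adjK e : adj (adj e) = e.
Proof. by rewrite /cx_adjoint /= linearN /= opprK !thetaK; case: e. Qed.
Lemma Hc_adj e f : Hc (adj e) (adj f) = Hc e f.
Proof.
have B := Bth_inner; by rewrite /cx_form /= (ipNl B) (ipNr B) opprK !Bth_theta.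
Qed.
Lemma Hc_cbr e f w : Hc (cbr e f) w = Hc f (cbr (adj e) w).
Proof.
have B := Bth_inner; rewrite /cx_form /cbr /=.
rewrite !(ipDl B, ipDr B, ipNl B, ipNr B, brNl) !Bth_br; ring.
Qed.
Lemma Hc_im e f : Hc (imul e) (imul f) = Hc e f.
Proof. have B := Bth_inner; by rewrite /cx_form /= (ipNl B) (ipNr B) opprK addrC. Qed.
Lemma Hc_imr e f : Hc e (imul f) = - Hc (imul e) f.
Proof. by rewrite -Hc_im imulK (ipNr Hc_inner). Qed.
Lemma Hc_im0 e : Hc e (imul e) = 0.
Proof. by have := Hc_imr e e; rewrite (ipC Hc_inner (imul e)); lra. Qed.
(** The components are compared through the form, which turns an identity in the
    vector space [g] into one in the field. *)
Lemma cbr_cbr e f w : cbr (cbr e f) w = cbr e (cbr f w) - cbr f (cbr e w).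
Proof.
have B := Bth_inner; rewrite /cbr /=.
by congr (_, _); apply: (ip_ext B) => u;
  rewrite /= !(brDl, brDr, brNl, brNr, br_br) !(ipDl B, ipNl B); ring.
Qed.

End Cartan.

(** * Root spaces *)

Section Roots.
Variables (R : realType) (g : lie_algebra R) (k p h0 : {vspace g}).
Hypothesis HC : cartan_decomposition k p.
Hypothesis HH : compact_cartan k h0.
Implicit Types (t : subvs_of h0) (e f z w : (g * g)%type).
Implicit Types (psi al be : weight R h0).

Let B := Bth_inner HC.
Let H := Hc_inner HC.
Local Notation Hc := (cx_form k p).
Local Notation adj := (cx_adjoint k p).
Local Notation theta := (cartan_involution k p).

Lemma h0_in_k t : vsval t \in k.
Proof. by case: HH => /subvP h _ _ _; apply: h; apply: subvsP. Qed.
Lemma br_h0 t t' : br g (vsval t) (vsval t') = 0.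
Proof. by case: HH => _ h _ _; apply: h; apply: subvsP. Qed.

Lemma killingR_Bth t t' : killingR t t' = cartan_form k p (vsval t) (vsval t').
Proof. by rewrite /killingR /cartan_form (theta_k HC (h0_in_k _)). Qed.

Lemma killingR_inner : inner_product (@killingR R g h0).
Proof.
split=> [a x y z|x y|x x0]; rewrite !killingR_Bth.
- by rewrite linearP (ipDl B) (ipZl B).
- by rewrite (ipC B).
- by rewrite (ip_gt0 B) // -(linear0 (@vsval _ _ h0)) (inj_eq val_inj).
Qed.
Let K := killingR_inner.

(** The Killing form is definite on [h0], hence identifies it with its dual. *)
Lemma hvecP psi t : psi t = killingR (hvec psi) t.
Proof.
suff: exists t0, (forall t', psi t' = killingR t0 t').
  by move=> [t0 h];
    exact: (@xgetPex _ 0 [set u | forall t', psi t' = killingR u t']%classic (ex_intro _ t0 h)).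
pose F : 'Hom(subvs_of h0, 'Hom(subvs_of h0, R^o)) :=
  linfun (fun t => ip_form (@killingR R g h0) t).
have FE t1 : F t1 = ip_form (@killingR R g h0) t1.
  have L : linear (fun t => ip_form (@killingR R g h0) t).
    move=> a u v; apply/lfunP => w.
    rewrite add_lfunE scale_lfunE !(ip_formE K) (ipDl K) (ipZl K) //.
  pose M := GRing.isLinear.Build _ _ _ _ _ L.
  pose f : {linear subvs_of h0 -> 'Hom(subvs_of h0, R^o)} :=
     HB.pack (fun t => ip_form (@killingR R g h0) t) M.
  by rewrite /F -[fun _ => _]/(f : subvs_of h0 -> _) lfunE.
have kF : lker F == 0%VS.
  rewrite -subv0; apply/subvP => u; rewrite memv_ker memv0 FE => /eqP h.
  by rewrite -(ip_eq0 K) -(ip_formE K) h zero_lfunE.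
have iF : limg F = fullv.
  apply/eqP; rewrite eqEdim subvf limg_dim_eq ?(eqP kF) ?capv0 //.
  by rewrite !dimvf /dim /= muln1.
have : psi \in limg F by rewrite iF memvf.
by case/memv_imgP => t0 _ ->; exists t0 => t'; rewrite FE (ip_formE K).
Qed.

Lemma wformE psi be : wform psi be = psi (hvec be).
Proof. by rewrite hvecP. Qed.

Lemma wform_inner : inner_product (@wform R g h0).
Proof.
split=> [a x y z|x y|x x0].
- by rewrite !wformE add_lfunE scale_lfunE.
- by rewrite /wform (ipC K).
rewrite /wform (ip_gt0 K) //; apply: contraNneq x0 => h.
by apply/eqP/lfunP => t; rewrite hvecP h (ip0l K) zero_lfunE.
Qed.
Let W := wform_inner.

(** The action of the element [i t] of [h_R]. *)
Definition cartan_act t : 'End((g * g)%type) := linfun (cbr ((0, vsval t) : (g * g)%type)).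

Lemma cartan_actE t z : cartan_act t z = cbr (0, vsval t) z.
Proof.
have L : linear (cbr ((0, vsval t) : (g * g)%type)).
  by move=> a u v; rewrite cbrDr cbrZr.
pose M := GRing.isLinear.Build _ _ _ _ _ L.
pose f : {linear (g * g)%type -> (g * g)%type} := HB.pack (cbr ((0, vsval t) : (g * g)%type)) M.
by rewrite /cartan_act -[cbr _]/(f : (g * g)%type -> _) lfunE.
Qed.

Lemma adj_t t : adj (0, vsval t) = (0, vsval t).
Proof. by rewrite /cx_adjoint /= linear0 oppr0 (theta_k HC (h0_in_k t)). Qed.

Lemma cartan_act_sym t : symmetric_op Hc (cartan_act t).
Proof. by move=> x y; rewrite !cartan_actE (Hc_cbr HC) adj_t. Qed.

Lemma cartan_act_comm t t' z : cartan_act t (cartan_act t' z) = cartan_act t' (cartan_act t z).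
Proof.
rewrite !cartan_actE; apply/eqP; rewrite -subr_eq0 -(cbr_cbr HC).
by rewrite [cbr (0, _) (0, _)]/cbr /= !br0l !br0r br_h0 !subr0 addr0 cbr0l.
Qed.

Lemma root_space_brE al a b t : root_space al (a, b) ->
  br g (vsval t) a = al t *: b /\ br g (vsval t) b = - (al t *: a).
Proof.
move=> /(_ t); rewrite /cbr /= !br0l !sub0r add0r => -[<- <-].
by rewrite opprK.
Qed.

(** The operators [ad (i t)], for [t] in [h0], commute and are symmetric for
    [cx_form], because [h0] is abelian and contained in [k]. *)
Lemma weight_basis : exists n (z : 'I_n -> (g * g)%type) (al : 'I_n -> weight R h0),
  [/\ forall i, root_space (al i) (z i),
      forall i j, Hc (z i) (z j) = (i == j)%:R
    & forall x, x = \sum_i Hc x (z i) *: z i].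
Proof.
have [n [z [w [h1 h2 h3]]]] := orthonormal_joint_eigenbasis H cartan_act_sym cartan_act_comm.
have L i : linear (w i : subvs_of h0 -> R^o).
  move=> a u v.
  have E t : w i t = Hc (cartan_act t (z i)) (z i) by rewrite h1 (ipZl H) h2 eqxx mulr1.
  rewrite !E !cartan_actE linearP.
  have -> : (0, a *: vsval u + vsval v) =
     a *: (0, vsval u) + (0, vsval v) :> (g * g)%type.
    by congr (_, _); rewrite /= ?scaler0 ?addr0.
  by rewrite cbrDl cbrZl (ipDl H) (ipZl H).
exists n, z, (fun i => linfun (w i : subvs_of h0 -> R^o)); split=> // i t.
pose M := GRing.isLinear.Build _ _ _ _ _ (L i).
pose f : {linear subvs_of h0 -> R^o} := HB.pack (w i : subvs_of h0 -> R^o) M.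
by rewrite -cartan_actE h1 -[w i]/(f : subvs_of h0 -> _) lfunE.
Qed.

Lemma root_spaceD al z w : root_space al z -> root_space al w -> root_space al (z + w).
Proof. by move=> hz hw t; rewrite cbrDr hz hw scalerDr. Qed.
Lemma root_spaceZ al a z : root_space al z -> root_space al (a *: z).
Proof. by move=> hz t; rewrite cbrZr hz !scalerA mulrC. Qed.
Lemma root_spaceN al z : root_space al z -> root_space al (- z).
Proof. by move=> hz; rewrite -scaleN1r; apply: root_spaceZ. Qed.
Lemma root_space_im al z : root_space al z -> root_space al (imul z).
Proof.
move=> hz t; rewrite cbr_imr hz; congr (_, _).
by rewrite /= scalerN.
Qed.
Lemma root_space_br al be e z : root_space al e -> root_space be z ->
  root_space (al + be) (cbr e z).
Proof.
move=> he hz t.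
have := cbr_cbr HC (0, vsval t) e z; rewrite he hz cbrZl cbrZr => /eqP.
by rewrite eq_sym subr_eq => /eqP ->; rewrite add_lfunE scalerDl.
Qed.
Lemma root_space_conj al a b : root_space al (a, b) -> root_space (- al) (a, - b).
Proof.
move=> /root_space_brE h t; have [h1 h2] := h t.
rewrite /cbr /= !br0l brNr h1 h2 !sub0r add0r opprK opp_lfunE.
by congr (_, _); rewrite /= ?scaleNr ?scalerN ?opprK.
Qed.
Lemma root_space_theta al a b : root_space al (a, b) -> root_space al (theta a, theta b).
Proof.
move=> /root_space_brE h t; have [h1 h2] := h t.
rewrite /cbr /= !br0l -[in LHS](theta_k HC (h0_in_k t)) -!(theta_br HC) h1 h2.
by rewrite !sub0r add0r linearN /= opprK !linearZ.
Qed.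
Lemma root_space_adj al e : root_space al e -> root_space (- al) (adj e).
Proof.
case: e => a b /root_space_theta /root_space_conj /root_spaceN.
by rewrite /cx_adjoint -[- (_, _)]/(- _, - - _) opprK.
Qed.

Lemma root_space_orth al be z w : root_space al z -> root_space be w -> al != be ->
  Hc z w = 0.
Proof.
move=> hz hw ab; apply/eqP/negPn/negP => zw.
case/eqP: ab; apply/lfunP => t; apply: (mulIf zw).
by rewrite -(ipZl H) -hz -cartan_actE cartan_act_sym cartan_actE hw (ipZr H).
Qed.

(** An element that commutes with [h0] normalizes the complexification of [h0],
    which is its own normalizer. *)
Lemma root_space_zero a b : root_space (0 : weight R h0) (a, b) <-> a \in h0 /\ b \in h0.
Proof.
split=> [/root_space_brE h|[ah bh] t].
  have E t : br g (vsval t) a = 0 /\ br g (vsval t) b = 0.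
    by have [-> ->] := h t; rewrite zero_lfunE !scale0r oppr0.
  case: HH => _ _ _ /(_ (a, b)) h4; apply: h4 => -[u v] [/= uh vh].
  have Eu x y : x \in h0 -> br g (vsval (vsproj h0 x)) y = br g x y.
    by move=> xh; rewrite vsprojK.
  split; rewrite /cbr /= (brC a) (brC b).
    by rewrite -(Eu u) // -(Eu v) // !(E _).1 !(E _).2 subrr mem0v.
  rewrite -(Eu u) // -(Eu v) // !(E _).1 !(E _).2.
  by rewrite oppr0 addr0 mem0v.
rewrite /cbr /= !br0l zero_lfunE scale0r.
rewrite -(vsprojK ah) -(vsprojK bh) !br_h0 //.
by rewrite subr0 addr0.
Qed.

(** The bracket has weight zero, hence lies in the complexification of [h0],
    where it is determined by its products with the elements of [h0] and of
    [i h0]; moving [ad e] across the form evaluates these products. *)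
Lemma cbr_adj al e : root_space al e ->
  cbr e (adj e) = Hc e e *: (0, vsval (hvec al)).
Proof.
move=> he.
have h0' : root_space (0 : weight R h0) (cbr e (adj e)).
  by rewrite -(subrr al); apply: root_space_br => //; apply: root_space_adj.
case E : (cbr e (adj e)) (h0') => [u v] /root_space_zero[uh vh].
have key t : Hc (u, v) (0, vsval t) = al t * Hc e e.
  rewrite -E (Hc_cbr HC) cbrC (root_space_adj he) (ipNr H) (ipZr H) opp_lfunE mulNr.
  by rewrite opprK (Hc_adj HC).
(* Here [t] is written as [- i (i t)]. *)
have key' t : Hc (u, v) (vsval t, 0) = 0.
  rewrite -E (Hc_cbr HC).
  have -> : (vsval t, 0) = - imul (0, vsval t) :> (g * g)%type.
    by congr (_, _); rewrite /= ?opprK ?oppr0.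
  rewrite cbrNr cbr_imr (cbrC (adj e)) (root_space_adj he).
  by rewrite imulN imulZ opprK (ipZr H) (Hc_im0 HC) mulr0.
have Hu : u = 0.
  apply/eqP; rewrite -(ip_eq0 B).
  have := key' (vsproj h0 u); rewrite /cx_form /= (ip0r B) addr0.
  by rewrite vsprojK // => ->.
have Hv : v = Hc e e *: vsval (hvec al).
  rewrite -(vsprojK vh) -linearZ; congr vsval; apply: (ip_ext K) => t.
  rewrite killingR_Bth (vsprojK vh) (ipZl K) -hvecP mulrC -key.
  by rewrite /cx_form /= (ip0r B) add0r.
by rewrite Hu Hv; congr (_, _); rewrite /= scaler0.
Qed.

(** The sl2 relation for [e] and its adjoint, paired with a vector of weight
    [be]: the sign of the product of [be] with the root decides whether [ad e]
    or its adjoint is nonzero on that vector. All that is needed about root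
    strings follows from this identity. *)
Lemma adj_root_string al be e z : root_space al e -> root_space be z ->
  wform be al * Hc e e * Hc z z =
  Hc (cbr (adj e) z) (cbr (adj e) z) - Hc (cbr e z) (cbr e z).
Proof.
move=> he hz; have := cbr_cbr HC e (adj e) z.
rewrite (cbr_adj he) cbrZl hz => /(congr1 (Hc z)).
rewrite !(ipZr H) (ipBr H) => E.
rewrite wformE -mulrA mulrCA E.
by rewrite !(Hc_cbr HC) (adjK HC).
Qed.

(** The part [w] of a root vector that is orthogonal to [e] and to [i e] is
    killed by the adjoint of [ad e], because [cx_adjoint e] sends it into the
    Cartan subalgebra, orthogonally to everything. As the product of a root
    with itself is positive, the sl2 relation then forces [w = 0]. *)
Lemma root_space_line al e z : al != 0 -> root_space al e -> e != 0 ->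
  root_space al z -> exists x y, z = x *: e + y *: imul e.
Proof.
move=> a0 he e0 hz.
pose x := Hc z e / Hc e e; pose y := Hc z (imul e) / Hc e e.
have ee : Hc e e != 0 by rewrite (ip_eq0 H).
exists x, y; apply/eqP; rewrite -subr_eq0.
set w := z - _.
have hw : root_space al w.
  by apply: root_spaceD => //; apply: root_spaceN; apply: root_spaceD; apply: root_spaceZ => //; apply: root_space_im.
have we : Hc w e = 0.
  rewrite (ipBl H) (ipDl H) !(ipZl H) (ipC H (imul e)) (Hc_im0 HC) mulr0 addr0.
  by rewrite mulfVK ?subrr.
have wi : Hc w (imul e) = 0.
  rewrite (ipBl H) (ipDl H) !(ipZl H) (Hc_im0 HC) (Hc_im HC) mulr0 add0r.
  by rewrite mulfVK ?subrr.
have h0' : root_space (0 : weight R h0) (cbr (adj e) w).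
  by rewrite -(addNr al); apply: root_space_br => //; apply: root_space_adj.
have aw : cbr (adj e) w = 0.
  case E : (cbr (adj e) w) (h0') => [u v] /root_space_zero[uh vh].
  have key t : Hc (u, v) (0, vsval t) = 0.
    rewrite -E (Hc_cbr HC) (adjK HC) cbrC he (ipNr H) (ipZr H).
    by rewrite we mulr0 oppr0.
  have key' t : Hc (u, v) (vsval t, 0) = 0.
    rewrite -E (Hc_cbr HC) (adjK HC).
    have -> : (vsval t, 0) = - imul (0, vsval t) :> (g * g)%type.
      by congr (_, _); rewrite /= ?opprK ?oppr0.
    rewrite cbrNr cbr_imr (cbrC e) he.
    by rewrite imulN imulZ opprK (ipZr H) wi mulr0.
  have Hu : u = 0.
    apply/eqP; rewrite -(ip_eq0 B).
    have := key' (vsproj h0 u); rewrite /cx_form /= (ip0r B) addr0.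
    by rewrite vsprojK // => ->.
  have Hv : v = 0.
    apply/eqP; rewrite -(ip_eq0 B).
    have := key (vsproj h0 v); rewrite /cx_form /= (ip0r B) add0r.
    by rewrite vsprojK // => ->.
  by rewrite Hu Hv.
have := adj_root_string he hw; rewrite aw (ip0l H) sub0r => E.
have haa := ip_gt0 W a0; have hee := ip_gt0 H e0; have hww := ip_ge0 H w.
have hc := ip_ge0 H (cbr e w).
rewrite -(ip_eq0 H) eq_le hww andbT.
rewrite -(pmulr_rle0 _ (mulr_gt0 haa hee)) E oppr_le0 //.
Qed.

Lemma root_string_br al be e z : root_space al e -> root_space be z ->
  e != 0 -> z != 0 -> wform be al < 0 -> cbr e z != 0.
Proof.
move=> he hz e0 z0 neg; apply: contraTneq neg => ez.
have := adj_root_string he hz; rewrite ez (ip0l H) subr0 => E.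
rewrite -leNgt -(pmulr_lge0 _ (ip_gt0 H e0)) -(pmulr_lge0 _ (ip_gt0 H z0)) E.
exact: ip_ge0 H _.
Qed.

Lemma root_string_adj al be e z : root_space al e -> root_space be z ->
  e != 0 -> z != 0 -> 0 < wform be al -> cbr (adj e) z != 0.
Proof.
move=> he hz e0 z0 pos; apply: contraTneq pos => ez.
have := adj_root_string he hz; rewrite ez (ip0l H) sub0r => E.
rewrite -leNgt -(pmulr_lle0 _ (ip_gt0 H e0)) -(pmulr_lle0 _ (ip_gt0 H z0)) E.
by rewrite oppr_le0; apply: ip_ge0 H _.
Qed.

Lemma cbr_adj_back e z : cbr (adj e) z != 0 -> cbr e (cbr (adj e) z) != 0.
Proof.
move=> h; apply: contraNneq h => ez; rewrite -(ip_eq0 H).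
by rewrite (Hc_cbr HC) (adjK HC) ez (ip0r H).
Qed.

(** The first bracket is nonzero as the product is negative. After it the
    product is still nonpositive, while the adjoint of [ad e] does not vanish;
    so the sl2 relation gives a second nonzero bracket. *)
Lemma root_string_br2 al be e z : root_space al e -> root_space be z ->
  e != 0 -> z != 0 -> al != 0 -> wform be al + wform al al <= 0 ->
  cbr e z != 0 /\ cbr e (cbr e z) != 0.
Proof.
move=> he hz e0 z0 a0 le.
have haa := ip_gt0 W a0.
have ez : cbr e z != 0 by apply: (root_string_br he hz) => //; lra.
split=> //.
have back : cbr (adj e) (cbr e z) != 0.
  by have := @cbr_adj_back (adj e) z; rewrite (adjK HC); apply.
apply: contraNneq (back) => eez; rewrite -(ip_eq0 H).
have := adj_root_string he (root_space_br he hz).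
rewrite eez (ip0l H) subr0 => E.
rewrite eq_le (ip_ge0 H) andbT -E (ipDl W).
rewrite pmulr_lle0 ?(ip_gt0 H) // pmulr_lle0 ?(ip_gt0 H) // addrC //.
Qed.

Lemma in_kc_theta a b : in_complexification k (a, b) <->
  (theta a = a /\ theta b = b).
Proof.
split=> [[ak bk]|[ha hb]]; first by rewrite !(theta_k HC).
by split; apply: (in_k HC).
Qed.

(** A root space is stable under the Cartan involution and is a complex line,
    so that it lies in one of the two eigenspaces of the involution. *)
Lemma root_dichotomy al : is_root al -> compact_root k al \/ noncompact_root p al.
Proof.
case=> a0 [[a b] hz z0].
have hth := root_space_theta hz.
pose zk : (g * g)%type := (a + theta a, b + theta b).
pose zp : (g * g)%type := (a - theta a, b - theta b).
have hk : root_space al zk := root_spaceD hz hth.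
have hp : root_space al zp := root_spaceD hz (root_spaceN hth).
have [zk0|zk0] := eqVneq zk 0.
  right=> w hw; have [x [y ->]] := root_space_line a0 hz z0 hw.
  case: zk0 => /eqP; rewrite addrC addr_eq0 => /eqP ha /eqP.
  rewrite addrC addr_eq0 => /eqP hb.
  have ap := in_p HC ha; have bp := in_p HC hb.
  by split; rewrite /= ?memvD ?memvZ ?memvN.
left=> w hw; have [x [y ->]] := root_space_line a0 hk zk0 hw.
have ak : a + theta a \in k by apply: (in_k HC); rewrite linearD /= (thetaK HC) addrC.
have bk : b + theta b \in k by apply: (in_k HC); rewrite linearD /= (thetaK HC) addrC.
by split; rewrite /= ?memvD ?memvZ ?memvN // memvD.
Qed.

Lemma k_cap_p x : x \in k -> x \in p -> x = 0.
Proof.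
move=> xk xp; apply/eqP; rewrite -memv0.
by have [_ <- _ _ _] := HC; rewrite memv_cap xk.
Qed.

Lemma kc_cap_pc z : in_complexification k z -> in_complexification p z -> z = 0.
Proof.
by case: z => a b [/= h1 h2] [/= h3 h4]; congr (_, _); apply: k_cap_p.
Qed.

Lemma not_both al : is_root al -> compact_root k al -> noncompact_root p al -> False.
Proof.
case=> _ [z hz z0] hk hp; case/eqP: z0; apply: kc_cap_pc; [exact: hk|exact: hp].
Qed.

Lemma compact_rootP al z : is_root al -> root_space al z -> z != 0 ->
  in_complexification k z -> compact_root k al.
Proof.
move=> ra hz z0 zk; have [//|/(_ z hz) zp] := root_dichotomy ra.
by case/eqP: z0; apply: kc_cap_pc.
Qed.

Lemma cbr_kk e z : in_complexification k e -> in_complexification k z ->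
  in_complexification k (cbr e z).
Proof.
by case: HC => _ _ [kk kp pp] _ _ [? ?] [? ?]; split; rewrite /= ?memvB ?memvD ?kk.
Qed.
Lemma cbr_kp e z : in_complexification k e -> in_complexification p z ->
  in_complexification p (cbr e z).
Proof.
by case: HC => _ _ [kk kp pp] _ _ [? ?] [? ?]; split; rewrite /= ?memvB ?memvD ?kp.
Qed.
Lemma cbr_pp e z : in_complexification p e -> in_complexification p z ->
  in_complexification k (cbr e z).
Proof.
by case: HC => _ _ [kk kp pp] _ _ [? ?] [? ?]; split; rewrite /= ?memvB ?memvD ?pp.
Qed.
Lemma cbr_pk e z : in_complexification p e -> in_complexification k z ->
  in_complexification p (cbr e z).
Proof.
by move=> ep zk; rewrite cbrC; case: (cbr_kp zk ep) => *; split; rewrite /= memvN.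
Qed.
Lemma adj_k e : in_complexification k e -> in_complexification k (adj e).
Proof. by case=> e1 e2; split; rewrite /= ?memvN (theta_k HC). Qed.
Lemma is_root_br al be e z : root_space al e -> root_space be z ->
  cbr e z != 0 -> al + be != 0 -> is_root (al + be).
Proof. by move=> he hz ez ab; split=> //; exists (cbr e z) => //; apply: root_space_br. Qed.

End Roots.

(** * Simple roots and the coefficient of the painted one *)
Section SimpleRoots.
Variables (R : realType) (g : lie_algebra R) (k p h0 : {vspace g}).
Hypothesis HC : cartan_decomposition k p.
Hypothesis HH : compact_cartan k h0.
Variables (l : nat) (gamma : 'I_l -> weight R h0).
Hypothesis HS : simple_roots gamma.
Implicit Types (e f z w : (g * g)%type).
Implicit Types (psi al be : weight R h0).
Implicit Types c d : 'I_l -> nat.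

Let B := Bth_inner HC.
Let H := Hc_inner HC.
Let W := wform_inner HC HH.
Local Notation Hc := (cx_form k p).
Local Notation adj := (cx_adjoint k p).

Definition comb c : weight R h0 := \sum_(i < l) gamma i *+ c i.

Let bas : basis_of fullv (map_tuple gamma (ord_tuple l)).
Proof. case: HS => _ h _; exact: h. Qed.

Let basE (i : 'I_l) : (map_tuple gamma (ord_tuple l))`_i = gamma i.
Proof.
by rewrite -[LHS](tnth_nth 0 (map_tuple gamma (ord_tuple l))) tnth_map tnth_ord_tuple.
Qed.

Lemma simple_root_coords psi :
  psi = \sum_(i < l) coord (map_tuple gamma (ord_tuple l)) i psi *: gamma i.
Proof.
rewrite {1}(coord_basis bas (memvf psi)).
by apply: eq_bigr => i _; rewrite basE.
Qed.

Lemma simple_roots_free (x : 'I_l -> R) :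
  \sum_(i < l) x i *: gamma i = 0 -> forall i, x i = 0.
Proof.
move=> h i; have := coord_sum_free x i (basis_free bas).
under eq_bigr do rewrite basE.
by rewrite h linear0.
Qed.

Lemma combE c : comb c = \sum_(i < l) (c i)%:R *: gamma i.
Proof. by apply: eq_bigr => i _; rewrite scaler_nat. Qed.

Lemma comb_inj c d : comb c = comb d -> c =1 d.
Proof.
rewrite !combE => /eqP; rewrite -subr_eq0 -sumrB => /eqP h i.
have /simple_roots_free/(_ i)/eqP : \sum_(i < l) ((c i)%:R - (d i)%:R) *: gamma i = 0.
  by rewrite -[RHS]h; apply: eq_bigr => j _; rewrite scalerBl.
by rewrite subr_eq0 eqr_nat => /eqP.
Qed.

Lemma combD c d : comb (fun i => c i + d i)%N = comb c + comb d.
Proof. by rewrite /comb -big_split; apply: eq_bigr => i _; rewrite mulrnDr. Qed.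

Definition delta i : 'I_l -> nat := fun j => (j == i : nat).

Lemma comb_delta i : comb (delta i) = gamma i.
Proof.
rewrite /comb (bigD1 i) //= /delta eqxx mulr1n big1 ?addr0 // => j.
by case: eqP => //; rewrite mulr0n.
Qed.

Lemma simple_is_root i : is_root (gamma i). Proof. by case: HS. Qed.

Lemma simple_positive i : positive_root gamma (gamma i).
Proof.
by split; [exact: simple_is_root | exists (delta i); rewrite -/(comb _) comb_delta].
Qed.

Lemma positive_or_neg al : is_root al -> positive_root gamma al \/ positive_root gamma (- al).
Proof. by case: HS => _ _; apply. Qed.

Lemma comb_eq0 c : comb c = 0 -> forall i, c i = 0%N.
Proof.
move=> h i; have := @comb_inj c (fun=> 0%N) _ i; apply.
by rewrite h /comb big1 // => j _; rewrite mulr0n.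
Qed.

Lemma positive_sum_neq0 al be : positive_root gamma al -> positive_root gamma be ->
  al + be != 0.
Proof.
move=> [[a0 _] [c E]] [_ [d F]]; rewrite -!/(comb _) in E F.
apply/eqP; rewrite E F -combD => /comb_eq0 h; case/eqP: a0; rewrite E.
rewrite /comb big1 // => i _; have := h i => /eqP; rewrite addn_eq0.
by case/andP => /eqP ->.
Qed.

Lemma positive_not_neg al : positive_root gamma al -> positive_root gamma (- al) -> False.
Proof. by move=> h1 h2; have := positive_sum_neq0 h1 h2; rewrite subrr eqxx. Qed.

Lemma positive_add al be : positive_root gamma al -> positive_root gamma be ->
  is_root (al + be) -> positive_root gamma (al + be).
Proof.
move=> [_ [c E]] [_ [d F]] r; split=> //.
by exists (fun i => c i + d i)%N; rewrite E F; exact: esym (combD c d).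
Qed.

Lemma simple_indecomposable i al be : positive_root gamma al -> positive_root gamma be ->
  gamma i != al + be.
Proof.
move=> [[a0 _] [c E]] [[b0 _] [d F]]; rewrite -!/(comb _) in E F.
apply/eqP; rewrite E F -comb_delta -combD => /comb_inj h.
have cd : c i = 0%N \/ d i = 0%N.
  by have := h i; rewrite /delta eqxx /=; lia.
have h' j : j != i -> c j = 0%N /\ d j = 0%N.
  by move=> ji; have := h j; rewrite /delta (negPf ji) /=; lia.
case: cd => cd.
  case/eqP: a0; rewrite E /comb big1 // => j _.
  by have [->|/h'[-> _]] := eqVneq j i; rewrite ?cd mulr0n.
case/eqP: b0; rewrite F /comb big1 // => j _.
by have [->|/h'[_ ->]] := eqVneq j i; rewrite ?cd mulr0n.
Qed.

Lemma wform_comb c psi : wform (comb c) psi = \sum_(i < l) (c i)%:R * wform (gamma i) psi.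
Proof. by rewrite combE (ip_suml W); apply: eq_bigr => i _; rewrite (ipZl W). Qed.

Lemma simple_wform_gt0 i : 0 < wform (gamma i) (gamma i).
Proof. by rewrite (ip_gt0 W) //; case: (simple_is_root i). Qed.

(** Twice the product with a simple root, expressed by Cartan integers: this
    translates products of roots into the integral Cartan matrix. *)
Lemma cartan_comb c i : 2 * wform (comb c) (gamma i) =
  (\sum_(j < l) (c j)%:R * cartan_matrix gamma i j) * wform (gamma i) (gamma i).
Proof.
rewrite wform_comb mulr_sumr mulr_suml; apply: eq_bigr => j _.
rewrite mxE (ipC W (gamma j)) -[RHS]mulrA mulfVK ?gt_eqF ?simple_wform_gt0 //.
by rewrite mulrCA.
Qed.

Lemma comb_add_simple c i : is_root (comb c) ->
  \sum_(j < l) (c j)%:R * cartan_matrix gamma i j <= -1 ->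
  is_root (comb (fun j => c j + delta i j)%N).
Proof.
move=> [c0 [z hz z0]] le; have [g0 [e he e0]] := simple_is_root i.
rewrite combD comb_delta addrC; apply: (is_root_br HC he hz).
  apply: (root_string_br HC HH he hz) => //.
  have := cartan_comb c i; have := simple_wform_gt0 i.
  by nra.
rewrite addrC -comb_delta -combD; apply/eqP => /comb_eq0 /(_ i).
by rewrite /delta eqxx addn1.
Qed.

Lemma comb_add_simple2 c i : is_root (comb c) ->
  \sum_(j < l) (c j)%:R * cartan_matrix gamma i j <= -2 ->
  is_root (comb (fun j => c j + 2 * delta i j)%N).
Proof.
move=> [c0 [z hz z0]] le; have [g0 [e he e0]] := simple_is_root i.
have [|ez eez] := root_string_br2 HC HH he hz e0 z0 g0.
  have := cartan_comb c i; have := simple_wform_gt0 i.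
  by nra.
have E : comb (fun j => c j + 2 * delta i j)%N = gamma i + (gamma i + comb c).
  rewrite addrA addrC -comb_delta -!combD.
  by congr comb; apply: funext => j; rewrite mul2n addnn.
rewrite E; apply: (is_root_br HC he (root_space_br HC he hz)) => //.
rewrite -E; apply/eqP => /comb_eq0 /(_ i).
by rewrite /delta eqxx addn2.
Qed.

(** The square of a root is positive and is a nonnegative combination of its
    products with the simple roots; hence one of these products is positive, and
    the corresponding simple root can be subtracted. *)
Lemma lowering_simple_root c z : is_root (comb c) -> root_space (comb c) z -> z != 0 ->
  exists i e, [/\ (0 < c i)%N, root_space (gamma i) e, e != 0
    & cbr (adj e) z != 0].
Proof.
move=> [c0 _] hz z0; have := ip_gt0 W c0; rewrite {1}wform_comb => pos.
have [i hi] : exists i, 0 < (c i)%:R * wform (gamma i) (comb c).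
  apply/existsP; apply: contraTT pos => /existsPn h; rewrite -leNgt.
  by apply: sumr_le0 => i _; rewrite leNgt.
have [g0 [e he e0]] := simple_is_root i.
have ci : (0 < c i)%N by case: (c i) hi => //; rewrite mul0r ltxx.
exists i, e; split=> //.
apply: (root_string_adj HC HH he hz) => //.
by move: hi; rewrite pmulr_rgt0 ?ltr0n // (ipC W).
Qed.

Section Painted.
Variable s : 'I_l.
Hypothesis nc_s : noncompact_root p (gamma s).
Hypothesis c_ns : forall i, i != s -> compact_root k (gamma i).
Hypothesis pp0 : forall al be e z, positive_root gamma al -> positive_root gamma be ->
  noncompact_root p al -> noncompact_root p be ->
  root_space al e -> root_space be z -> cbr e z = 0.

(** The painted simple root occurs with coefficient at most one, and does not
    occur at all in compact roots: stripping simple roots one by one, the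
    painted one can only be removed from a noncompact root, leaving a compact
    one, since two positive noncompact root vectors commute. *)
Lemma painted_coef c : is_root (comb c) ->
  (c s <= 1)%N /\ (compact_root k (comb c) -> c s = 0%N).
Proof.
have [m] := ubnP (\sum_i c i)%N; elim: m c => // m IH c /ltnSE cm rc.
have [c0 [z hz z0]] := rc.
have [i [e [ci he e0 fz0]]] := lowering_simple_root rc hz z0.
pose d j := (c j - delta i j)%N.
have Ecd j : c j = (d j + delta i j)%N.
  by rewrite /d /delta; case: eqP => [->|_]; rewrite ?subn0 ?addn0 // subnK.
have Ec : comb c = comb d + gamma i.
  by rewrite -comb_delta -combD; congr comb; apply: funext.
have hf : root_space (comb d) (cbr (adj e) z).
  have -> : comb d = - gamma i + comb c by rewrite Ec addrCA addNr addr0.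
  exact: (root_space_br HC (root_space_adj HC HH he) hz).
have efz := cbr_adj_back HC fz0.
have [d0|d0] := eqVneq (comb d) 0.
  have Es : c s = delta i s by rewrite Ecd (comb_eq0 d0).
  rewrite Es /delta; split; first by case: eqP.
  rewrite Ec d0 add0r; case: eqP => // <- ck.
  by case: (not_both HC (simple_is_root s) ck nc_s).
have rd : is_root (comb d) by split=> //; exists (cbr (adj e) z).
have [|IH1 IH2] := IH d _ rd.
  apply: leq_trans cm; rewrite [X in (_ < X)%N](eq_bigr (fun j => d j + delta i j)%N) //.
  rewrite big_split /= -[X in (X < _)%N]addn0 ltn_add2l lt0n sum_nat_eq0.
  apply/negP => /forallP /(_ i); by rewrite /delta eqxx.
have posd : positive_root gamma (comb d) by split=> //; exists d.
(* Removing a compact simple root keeps both the type and the coefficient. *)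
have [Ei|nis] := eqVneq i s; last first.
  have Es : c s = d s by rewrite Ecd /delta eq_sym (negPf nis) addn0.
  rewrite Es; split=> // ck; apply: IH2.
  apply: (compact_rootP HC HH rd hf fz0).
  by apply: (cbr_kk HC); [apply: (adj_k HC); apply: c_ns he | apply: ck].
have Es : c s = (d s).+1 by rewrite Ecd /delta Ei eqxx addn1.
have ds0 : compact_root k (comb d).
  have [//|ncd] := root_dichotomy HC HH rd.
  have nci : noncompact_root p (gamma i) by rewrite Ei.
  by case/eqP: efz; apply: (pp0 (simple_positive i) posd).
rewrite Es IH2 //; split=> // ck.
have ecz : root_space (comb c) (cbr e (cbr (adj e) z)).
  by rewrite Ec addrC; apply: (root_space_br HC).
case/eqP: efz; apply: (kc_cap_pc HC); first exact: ck.
apply: (cbr_pk HC); last exact: ds0.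
by apply: nc_s; rewrite -Ei.
Qed.

(** * Flux of weights and special weights *)
Section Flux.
Variables (n : nat) (z : 'I_n -> (g * g)%type) (al : 'I_n -> weight R h0).
Hypothesis zrs : forall i, root_space (al i) (z i).
Hypothesis zon : forall i j, Hc (z i) (z j) = (i == j)%:R.
Hypothesis zsp : forall x, x = \sum_i Hc x (z i) *: z i.

Lemma z_neq0 i : z i != 0.
Proof. by rewrite -(ip_eq0 H) zon eqxx oner_eq0. Qed.

Lemma parseval x : Hc x x = \sum_i Hc x (z i) ^+ 2.
Proof.
rewrite {2}(zsp x) (ip_sumr H); apply: eq_bigr => i _.
by rewrite (ipZr H) expr2.
Qed.

(** Squared matrix coefficients of [ad e], seen as a flow from the weight of the
    first vector to that of the second one. *)
Definition flow e i j := Hc (cbr e (z i)) (z j) ^+ 2.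

Lemma flow_ge0 e i j : 0 <= flow e i j. Proof. exact: sqr_ge0. Qed.

Lemma flow_weight be e i j : root_space be e -> flow e i j != 0 -> al j = be + al i.
Proof.
move=> he; apply: contra_neq_eq => ne; rewrite /flow.
by rewrite (root_space_orth HC HH (root_space_br HC he (zrs i)) (zrs j)) ?expr0n // eq_sym.
Qed.

(** By Parseval, the sl2 relation for one basis vector says that its product
    with the root is its incoming minus its outgoing flow. In the sum over a set
    of basis vectors the flow inside the set cancels. *)
Lemma flux (P : pred 'I_n) be e : root_space be e ->
  (\sum_(i | P i) wform (al i) be) * Hc e e =
  \sum_(i | P i) \sum_(j | ~~ P j) (flow e j i - flow e i j).
Proof.
move=> he; rewrite mulr_suml.
transitivity (\sum_(i | P i) \sum_j (flow e j i - flow e i j)).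
  apply: eq_bigr => i _; have := adj_root_string HC HH he (zrs i).
  rewrite zon eqxx mulr1 => ->; rewrite !parseval -sumrB; apply: eq_bigr => j _.
  by rewrite /flow (Hc_cbr HC (adj e)) (adjK HC) (ipC H).
under eq_bigr => i _ do rewrite (bigID P) /=.
rewrite big_split /= -[RHS]add0r; congr (_ + _).
under eq_bigr => i _ do rewrite sumrB.
by rewrite sumrB [X in _ - X]exchange_big /= subrr.
Qed.

Lemma flux_le0 (P : pred 'I_n) be e : root_space be e -> e != 0 ->
  (forall i j, P i -> ~~ P j -> flow e j i = 0) ->
  \sum_(i | P i) wform (al i) be <= 0.
Proof.
move=> he e0 h; rewrite -(pmulr_lle0 _ (ip_gt0 H e0)) (flux P he).
apply: sumr_le0 => i Pi; apply: sumr_le0 => j Pj.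
by rewrite (h i j) // sub0r oppr_le0 flow_ge0.
Qed.

Lemma flux_gt0 (P : pred 'I_n) be e : root_space be e -> e != 0 ->
  (forall i j, P i -> ~~ P j -> flow e i j = 0) ->
  (exists i j, [/\ P i, ~~ P j & flow e j i != 0]) ->
  0 < \sum_(i | P i) wform (al i) be.
Proof.
move=> he e0 h [i [j [Pi Pj ne]]].
rewrite -(pmulr_lgt0 _ (ip_gt0 H e0)) (flux P he).
have ge0 i' : P i' -> 0 <= \sum_(j | ~~ P j) (flow e j i' - flow e i' j).
  by move=> Pi'; apply: sumr_ge0 => j' Pj'; rewrite (h i') // subr0 flow_ge0.
rewrite (bigD1 i) //= ltr_wpDr //; first by apply: sumr_ge0 => i' /andP[/ge0].
rewrite (bigD1 j) //= (h i j) // subr0 ltr_wpDr //.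
  by apply: sumr_ge0 => j' /andP[Pj' _]; rewrite (h i j') // subr0 flow_ge0.
by rewrite lt_neqAle eq_sym ne flow_ge0.
Qed.

Lemma root_index be : is_root be -> exists i, al i = be.
Proof.
move=> [b0 [e he e0]].
have [i hi] : exists i, Hc e (z i) != 0.
  apply/existsP; apply: contraNT e0 => /existsPn h.
  rewrite (zsp e) big1 // => i _; have /negPn/eqP -> := h i.
  by rewrite scale0r.
exists i; apply/eqP; apply: contraNT hi => ne.
by rewrite (root_space_orth HC HH he (zrs i)) // eq_sym.
Qed.

Variable phi : weight R h0.
Hypothesis dom : dominant gamma phi.
Hypothesis nc_phi : forall be, positive_root gamma be -> noncompact_root p be ->
  wform phi be != 0.
Variable lam : R.
Hypothesis special_eq : forall be, positive_root gamma be -> wform phi be != 0 ->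
  - lam * wform phi be =
  \sum_(i | `[< positive_root gamma (al i) >] && (wform phi (al i) != 0))
     eps p (al i) * wform (al i) be.

Let Pnc i := `[< positive_root gamma (al i) >] && `[< noncompact_root p (al i) >].
Let Qc i := [&& `[< positive_root gamma (al i) >], wform phi (al i) != 0
  & ~~ `[< noncompact_root p (al i) >]].
Let Pv := \sum_(i | Pnc i) al i.
Let Qv := \sum_(i | Qc i) al i.

Let special_eq' be : positive_root gamma be -> wform phi be != 0 ->
  - lam * wform phi be = wform Pv be - wform Qv be.
Proof.
move=> pb fb; rewrite special_eq // (bigID (fun i => `[< noncompact_root p (al i) >])) /=.
rewrite !(ip_suml W) -sumrN; congr (_ + _).
  apply: eq_big => i; last by move=> /andP[_ h]; rewrite /eps h mul1r.
  rewrite /Pnc; apply/andP/andP => [[/andP[]]//|[h1 h2]].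
  by split=> //; rewrite h1 /=; apply: nc_phi; apply/asboolP.
apply: eq_big => i; first by rewrite /Qc andbA.
by move=> /andP[_ /negPf h]; rewrite /eps h mulN1r.
Qed.

Let Qc_compact i : Qc i -> [/\ positive_root gamma (al i), 0 < wform phi (al i)
   & compact_root k (al i)].
Proof.
case/and3P => /asboolP pos ne /asboolP nn; split=> //.
  by rewrite lt_neqAle eq_sym ne dom.
by have [] := root_dichotomy HC HH pos.1.
Qed.

(** Adding an unpainted, hence compact, simple root to a weight that is not
    positive noncompact never gives one that is: there is no inflow. *)
Let Pnc_simple i : i != s -> wform Pv (gamma i) <= 0.
Proof.
move=> nis; have [g0 [e he e0]] := simple_is_root i.
rewrite (ip_suml W); apply: (flux_le0 he e0) => j m Pj; apply: contraNeq => fl.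
have E := flow_weight he fl.
case/andP: Pj => /asboolP pj /asboolP nj.
have ez0 : cbr e (z m) != 0.
  by apply: contraNneq fl => h; rewrite /flow h (ip0l H) expr0n.
have ck := c_ns nis.
have m0 : al m != 0.
  apply/eqP => h; rewrite h addr0 in E.
  by apply: (not_both HC (simple_is_root i) ck); rewrite -E.
have rm : is_root (al m) by split=> //; exists (z m); rewrite ?z_neq0.
have ncm : noncompact_root p (al m).
  have [cm|//] := root_dichotomy HC HH rm.
  case/eqP: ez0; apply: (kc_cap_pc HC).
    by apply: (cbr_kk HC); [apply: ck | apply: cm].
  by apply: nj; rewrite E; apply: (root_space_br HC).
apply/andP; split; apply/asboolP => //.
have [//|neg] := positive_or_neg rm.
have := simple_indecomposable i pj neg.
by rewrite E addrK eqxx.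
Qed.

(** The set is stable under addition of an unpainted simple root, so nothing
    flows out, whereas the Cartan subalgebra flows into the simple root. *)
Let Qc_simple i : i != s -> wform phi (gamma i) != 0 -> 0 < wform Qv (gamma i).
Proof.
move=> nis fi; have [g0 [e he e0]] := simple_is_root i.
have ck := c_ns nis.
rewrite (ip_suml W); apply: (flux_gt0 he e0) => [j m Qj|].
  apply: contraNeq => fl; have E := flow_weight he fl.
  have [pj fj cj] := Qc_compact Qj.
  have ez0 : cbr e (z j) != 0.
    by apply: contraNneq fl => h; rewrite /flow h (ip0l H) expr0n.
  have rm : is_root (al m).
    rewrite E; apply: (is_root_br HC he (zrs j)) => //.
    by apply: positive_sum_neq0 => //; apply: simple_positive.
  have cm : compact_root k (al m).
    apply: (compact_rootP HC HH rm _ ez0); first by rewrite E; apply: (root_space_br HC).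
    by apply: (cbr_kk HC); [apply: ck | apply: cj].
  apply/and3P; split.
  - by apply/asboolP; rewrite E; apply: positive_add; rewrite -?E //; apply: simple_positive.
  - by rewrite E (ipDr W) gt_eqF // ltr_wpDl // dom //; apply: simple_positive.
  - by apply/asboolP => nm; apply: (not_both HC rm cm nm).
have [j Ej] := root_index (simple_is_root i).
have fz : cbr (adj e) (z j) != 0.
  by apply: (root_string_adj HC HH he (zrs j)); rewrite ?z_neq0 // Ej simple_wform_gt0.
have [m hm] : exists m, Hc (cbr (adj e) (z j)) (z m) != 0.
  apply/existsP; apply: contraNT fz => /existsPn h.
  rewrite (zsp (cbr (adj e) _)) big1 // => m _; have /negPn/eqP -> := h m.
  by rewrite scale0r.
have fl : flow e m j != 0.
  by rewrite /flow sqrf_eq0 (ipC H) -[e](adjK HC) -(Hc_cbr HC).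
exists j, m; split=> //.
  apply/and3P; rewrite Ej; split=> //; apply/asboolP; first exact: simple_positive.
  by move=> nn; apply: (not_both HC (simple_is_root i) ck nn).
apply/negP => /Qc_compact[[[m0 _] _] _ _].
have := flow_weight he fl; rewrite Ej => /eqP.
by rewrite -subr_eq0 opprD addNKr oppr_eq0 (negPf m0).
Qed.

(** Let [P] be the sum of the positive noncompact roots and [Q] the sum of the
    positive compact roots that are not orthogonal to the weight. Pairing the
    equation with [P] gives [lam * (phi, P) = (Q, P) - (P, P)], which is negative
    because [Q] involves only unpainted simple roots, and these have nonpositive
    product with [P]. Pairing it with an unpainted simple root not orthogonal to
    the weight would give a positive [lam]. *)
Lemma unpainted_orthogonal i : i != s -> wform phi (gamma i) = 0.
Proof.
move=> nis; apply/eqP/negPn/negP => fi.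
have [j Ej] := root_index (simple_is_root s).
have Pj : Pnc j.
  by rewrite /Pnc Ej; apply/andP; split; apply/asboolP => //; exact: simple_positive.
have Ppos m : Pnc m -> 0 < wform phi (al m).
  case/andP => /asboolP h1 /asboolP h2.
  by rewrite lt_neqAle eq_sym nc_phi //= dom.
have fP : 0 < wform phi Pv.
  rewrite (ip_sumr W) (bigD1 j) //= ltr_wpDr ?Ppos //.
  by apply: sumr_ge0 => m /andP[/Ppos/ltW].
have P0 : Pv != 0 by apply: contraTneq fP => ->; rewrite (ip0r W) ltxx.
have QP : wform Qv Pv <= 0.
  rewrite (ip_suml W); apply: sumr_le0 => m /Qc_compact[[rm [c E]] _ cm].
  rewrite E -/(comb _) in rm cm *.
  have [_ /(_ cm) cs] := painted_coef rm.
  rewrite wform_comb; apply: sumr_le0 => i' _.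
  have [->|ne] := eqVneq i' s; first by rewrite cs mul0r.
  by rewrite mulr_ge0_le0 ?ler0n // (ipC W) Pnc_simple.
have lneg : lam < 0.
  have E : - lam * wform phi Pv = wform Pv Pv - wform Qv Pv.
    rewrite [in LHS](ip_sumr W) mulr_sumr [X in _ = X - _](ip_sumr W).
    rewrite [X in _ = _ - X](ip_sumr W) -sumrB; apply: eq_bigr => m Pm.
    case/andP: (Pm) => /asboolP h1 /asboolP h2.
    by apply: special_eq' => //; apply: nc_phi.
  have := ip_gt0 W P0; nra.
have := special_eq' (simple_positive i) fi.
have h1 := Pnc_simple nis; have h2 := Qc_simple nis fi.
have h3 : 0 < wform phi (gamma i).
  by rewrite lt_neqAle eq_sym fi dom //; apply: simple_positive.
nra.
Qed.

End Flux.
End Painted.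
End SimpleRoots.

(** * Geometry of the orbit *)
Section OrbitGeometry.
Variables (R : realType) (g : lie_algebra R) (k p h0 : {vspace g}).
Hypothesis HC : cartan_decomposition k p.
Hypothesis HH : compact_cartan k h0.
Variables (l : nat) (gamma : 'I_l -> weight R h0).
Hypothesis HS : simple_roots gamma.
Variable phi : weight R h0.
Implicit Types (e f z w : (g * g)%type) (x y u : g) (psi al be : weight R h0).

Let B := Bth_inner HC.
Let H := Hc_inner HC.
Let W := wform_inner HC HH.
Local Notation Hc := (cx_form k p).
Local Notation adj := (cx_adjoint k p).
Local Notation v := (ivec phi).
Local Notation m := (orbit_tangent v).
Local Notation stab := (lie_stab v).

Lemma mem_killing_orth (U : {vspace g}) y :
  reflect (forall u, u \in U -> killing u y = 0) (y \in killing_orth U).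
Proof.
have E u y' : linfun (fun y => killing u y : R^o) y' = killing u y'.
  have L : linear (fun y => killing u y : R^o).
    by move=> a s t; rewrite killingDr killingZr.
  pose M := GRing.isLinear.Build _ _ _ _ _ L.
  pose f : {linear g -> R^o} := HB.pack (fun y => killing u y : R^o) M.
  by rewrite -[fun _ => _]/(f : g -> _) lfunE.
have -> : (y \in killing_orth U) = [forall i : 'I_(\dim U), killing (vbasis U)`_i y == 0].
  rewrite /killing_orth memvE; apply/subv_bigcapP/forallP => h i.
    by have := h i isT; rewrite -memvE memv_ker E.
  by move=> _; rewrite -memvE memv_ker E.
apply: (iffP forallP) => [h u uU|h i].
  rewrite (coord_vbasis uU) killingC.
  rewrite (big_morph (killing y) (fun a b => killingDr a b y) (id1 := 0)); last first.
    by rewrite killingC killing0l.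
  by apply: big1 => i _; rewrite killingZr killingC (eqP (h i)) mulr0.
by apply/eqP/h/vbasis_mem; rewrite mem_nth ?size_tuple.
Qed.

Lemma br_ivec al a b : root_space al (a, b) ->
  br g v a = - (wform phi al *: b) /\ br g v b = wform phi al *: a.
Proof.
move=> h; have [h1 h2] := root_space_brE (hvec phi) h.
by rewrite /ivec !brNl h1 h2 opprK (ipC W) (wformE HC HH).
Qed.

Lemma ivec_in_k : v \in k.
Proof. by rewrite memvN; apply: (h0_in_k HH). Qed.

(** The isotropy algebra is stable under the Cartan involution, so that the
    Killing form is nondegenerate on it. *)
Lemma tangent_cap_stab : (m :&: stab)%VS = 0%VS.
Proof.
apply/eqP; rewrite -subv0; apply/subvP => x; rewrite memv_cap memv0.
case/andP => /mem_killing_orth h; rewrite memv_ker => /eqP vx.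
rewrite -(ip_eq0 B) /cartan_form -(killing_thetaC HC) h ?oppr0 //.
rewrite memv_ker -[v](theta_k HC ivec_in_k) -(theta_br HC) vx linear0 //.
Qed.

Lemma h0_stab (t : subvs_of h0) : vsval t \in stab.
Proof. by rewrite memv_ker /ivec brNl (br_h0 HH) oppr0. Qed.

(** On these root planes [ad v] is invertible and skew for the Killing form. *)
Lemma root_tangent al a b : root_space al (a, b) -> wform phi al != 0 ->
  a \in m /\ b \in m.
Proof.
move=> h ne.
have key al' a' b' : root_space al' (a', b') -> wform phi al' != 0 -> a' \in m.
  move=> h' ne'; apply/mem_killing_orth => u; rewrite memv_ker => /eqP vu.
  have [_ E] := br_ivec h'.
  rewrite -[a'](scalerK ne') -E killingZr -killing_br (brC u) vu oppr0 killing0l mulr0 //.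
split; first exact: key h ne.
by rewrite -memvN; apply: key (root_space_im h) ne.
Qed.

Lemma mspace_root al a b : root_space al (a, b) -> mspace al a /\ mspace al b.
Proof.
have key a' b' : root_space al (a', b') -> mspace al a'.
  move=> h; exists (2^-1 *: (a', b')), (2^-1 *: (a', - b')); split.
  - exact: root_spaceZ.
  - by apply: root_spaceZ; apply: root_space_conj.
  rewrite -scalerDr; congr (_, _); rewrite /= ?subrr ?scaler0 //.
  have -> : a' + a' = 2 *: a' by rewrite scaler_nat mulr2n.
  by rewrite scalerA mulVf ?scale1r ?pnatr_eq0.
move=> h; split; first exact: key h.
have h' : root_space al (b, - a).
  by have := root_spaceN (root_space_im h); rewrite /imul -[- (_, _)]/(- _, - _) /= opprK.
exact: key h'.
Qed.

Section AlmostComplex.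
Variable J : 'End(g).
Hypothesis HJ : canonical_acs p gamma phi J.

Lemma acs_root al a b : positive_root gamma al -> wform phi al != 0 ->
  root_space al (a, b) -> J a = - (eps p al *: b) /\ J b = eps p al *: a.
Proof.
move=> pos ne h; have [ma mb] := mspace_root h; have [Ea Eb] := br_ivec h.
rewrite !(HJ pos ne) // Ea Eb scalerN !scalerA mulfVK //.
Qed.
End AlmostComplex.

Hypothesis dom : dominant gamma phi.
Hypothesis nc_phi : forall be, positive_root gamma be -> noncompact_root p be ->
  wform phi be != 0.

Lemma eps_noncompact al : noncompact_root p al -> eps p al = 1.
Proof. by move=> h; rewrite /eps; case: asboolP. Qed.
Lemma eps_compact al : is_root al -> compact_root k al -> eps p al = -1.
Proof.
by move=> r c; rewrite /eps; case: asboolP => // n; case: (not_both HC r c n).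
Qed.

(** Let [A + i C] be the bracket of [a + i b] and [a' + i b'], vectors of two
    positive noncompact root spaces. If it is not zero, it is a root vector for
    a positive compact root, on which the almost complex structure has the
    opposite sign, and the Nijenhuis tensor at [a, a'] equals [- A / 2].
    Multiplying the first vector by i gives [C = 0] in the same way. *)
Lemma integrable_noncompact_commute : integrable_weight p gamma phi ->
  forall al be e z, positive_root gamma al -> positive_root gamma be ->
  noncompact_root p al -> noncompact_root p be ->
  root_space al e -> root_space be z -> cbr e z = 0.
Proof.
move=> [J HJ N0] al be e z pa pb na nb he hz.
have fa := nc_phi pa na; have fb := nc_phi pb nb.
have fab : wform phi (al + be) != 0.
  have ga : 0 < wform phi al by rewrite lt_neqAle eq_sym fa dom.
  have gb : 0 < wform phi be by rewrite lt_neqAle eq_sym fb dom.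
  by rewrite (ipDr W) gt_eqF // addr_gt0.
have key e' : root_space al e' -> (cbr e' z).1 = 0.
  move=> he'; have [->//|ne] := eqVneq (cbr e' z) 0.
  have rab : is_root (al + be).
    by apply: (is_root_br HC he' hz ne); apply: (positive_sum_neq0 HS).
  have pab := positive_add pa pb rab.
  have hab := root_space_br HC he' hz.
  have cab : compact_root k (al + be).
    by apply: (compact_rootP HC HH rab hab ne); apply: (cbr_pp HC); [apply: na | apply: nb].
  case: e' z he' hz {ne} hab => [a b] [a' b'] he' hz' hab.
  set A := (cbr (a, b) (a', b')).1; set C := (cbr (a, b) (a', b')).2.
  have hAC : root_space (al + be) (A, C) by [].
  have [Am Cm] := root_tangent hAC fab.
  have [_ JC] := acs_root HJ pab fab hAC.
  have [Ja Jb] := acs_root HJ pa fa he'.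
  have [Ja' Jb'] := acs_root HJ pb fb hz'.
  have [am bm] := root_tangent he' fa; have [am' bm'] := root_tangent hz' fb.
  rewrite !eps_noncompact // !scale1r in Ja Jb Ja' Jb'.
  rewrite eps_compact // scaleN1r in JC.
  have := N0 _ _ am am'; rewrite /nijenhuis Ja Ja' => /eqP.
  rewrite scaler_eq0 invr_eq0 pnatr_eq0 /= !(brNl, brNr) opprK.
  set pm := pr_tangent v.
  have E : pm (br g b b') - J (pm (- br g b a')) - J (pm (- br g a b')) - pm (br g a a')
     = - pm A + J (pm C).
    have -> : pm A = pm (br g a a') - pm (br g b b') := linearB pm _ _.
    have -> : J (pm C) = J (pm (br g a b')) + J (pm (br g b a')).
      by rewrite -linearD /= -linearD.
    rewrite !linearN /= !linearN /= !opprK opprB.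
    by rewrite [RHS]addrAC (addrC (J (pm (br g a b')))) addrA.
  rewrite E /pm /pr_tangent !daddv_pi_id ?tangent_cap_stab // JC.
  by rewrite -opprD oppr_eq0 -mulr2n -scaler_nat scaler_eq0 pnatr_eq0 => /eqP.
have k2 : - (cbr e z).2 = 0 by have := key _ (root_space_im he); rewrite cbr_iml.
by rewrite [cbr e z]surjective_pairing (key _ he) -[_.2]opprK k2 oppr0.
Qed.

Section Curvature.
Variables (n : nat) (z : 'I_n -> (g * g)%type) (al : 'I_n -> weight R h0).
Hypothesis zrs : forall i, root_space (al i) (z i).
Hypothesis zon : forall i j, Hc (z i) (z j) = (i == j)%:R.
Hypothesis zsp : forall w, w = \sum_i Hc w (z i) *: z i.

Let I : {pred 'I_n} :=
  [pred i | `[< positive_root gamma (al i) >] && (wform phi (al i) != 0)].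

Let zrs' i : root_space (al i) ((z i).1, (z i).2).
Proof. by case: (z i) (zrs i). Qed.

(** The real parts of the basis vectors whose weight is positive and not
    orthogonal to [phi] turn out to form a basis of the tangent space. *)
Let X : #|I|.-tuple g := [tuple (z (enum_val j)).1 | j < #|I|].

Let XE (j : 'I_#|I|) : X`_j = (z (enum_val j)).1.
Proof. by rewrite -tnth_nth tnth_mktuple. Qed.

Let IP (j : 'I_#|I|) : positive_root gamma (al (enum_val j)) /\
  wform phi (al (enum_val j)) != 0.
Proof. by move: (enum_valP j); rewrite unfold_in => /andP[/asboolP]. Qed.

(** If a combination of the vectors [z_i] has zero real part, conjugation changes
    its sign; but conjugation maps positive weights to negative ones, whose
    weight spaces are orthogonal to it. *)
Let X_free : free X.
Proof.
apply/freeP => c; under eq_bigr do rewrite XE.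
move=> c0 j0.
pose y : (g * g)%type := \sum_j c j *: z (enum_val j).
have y1 : y.1 = 0.
  by rewrite -c0 /y (raddf_sum (@fst g g)); apply: eq_bigr => j _.
have yN : - y = \sum_j c j *: ((z (enum_val j)).1, - (z (enum_val j)).2).
  rewrite [LHS]surjective_pairing [RHS]surjective_pairing; congr (_, _).
    by rewrite /= y1 oppr0 -[LHS]c0 (raddf_sum (@fst g g)).
  rewrite (raddf_sum (@snd g g)) /= /y (raddf_sum (@snd g g)) -sumrN.
  by apply: eq_bigr => j _; rewrite /= scalerN.
have yy : Hc y y = 0.
  rewrite -[LHS]opprK -(ipNr H) yN (ip_sumr H) big1 ?oppr0 // => j _.
  rewrite (ipZr H) (ip_suml H) big1 ?mulr0 // => j' _; rewrite (ipZl H).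
  rewrite (root_space_orth HC HH (zrs _) (root_space_conj (zrs' _))) ?mulr0 //.
  apply/eqP => E; have [h1 _] := IP j'; have [h2 _] := IP j.
  by apply: (positive_not_neg HS h2); rewrite -E.
have y0 : y = 0 by apply/eqP; rewrite -(ip_eq0 H) yy.
have : Hc y (z (enum_val j0)) = 0 by rewrite y0 (ip0l H).
rewrite (ip_suml H) (bigD1 j0) //= (ipZl H) zon eqxx mulr1 big1 ?addr0 // => j jj.
by rewrite (ipZl H) zon (inj_eq enum_val_inj) (negPf jj) mulr0.
Qed.

Let X_mem i : i \in I -> (z i).1 \in <<X>>%VS.
Proof.
move=> iI; apply: memv_span.
have -> : (z i).1 = X`_(enum_rank_in iI i) by rewrite XE enum_rankK_in.
by rewrite mem_nth ?size_tuple.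
Qed.

Let X_sub : (<<X>> <= m)%VS.
Proof.
apply/span_subvP => x /tnthP[j ->]; rewrite tnth_mktuple.
have [_ ne] := IP j.
by have [] := root_tangent (zrs' (enum_val j)) ne.
Qed.

(** The real parts of the basis vectors span [g]. Those of weight orthogonal to
    [phi] belong to the isotropy algebra, and those of negative weight are
    combinations of real parts of positive weight, by conjugation. *)
Let X_span : (m <= <<X>>)%VS.
Proof.
apply/subvP => x xm.
pose c i := Hc (x, 0) (z i).
have Ex : x = \sum_i c i *: (z i).1.
  by have := congr1 fst (zsp (x, 0)); rewrite (raddf_sum (@fst g g)).
rewrite Ex (bigID (fun i => wform phi (al i) == 0)) /= in xm *.
set s := \sum_(i | _ == 0) _ in xm *; set y := \sum_(i | _ != 0) _ in xm *.
have yX : y \in <<X>>%VS.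
  apply: memv_suml => i ne; rewrite memvZ //.
  have [a0|a0] := eqVneq (al i) 0; first by rewrite a0 (ip0r W) eqxx in ne.
  have ri : is_root (al i).
    split=> //; exists (z i) => //.
    by rewrite -(ip_eq0 H) zon eqxx oner_eq0.
  have [pos|neg] := positive_or_neg HS ri.
    by apply: X_mem; rewrite unfold_in /= ne andbT; apply/asboolP.
  have hc := root_space_conj (zrs' i).
  have -> : (z i).1 = \sum_j Hc ((z i).1, - (z i).2) (z j) *: (z j).1.
    by have := congr1 fst (zsp ((z i).1, - (z i).2)); rewrite (raddf_sum (@fst g g)).
  apply: memv_suml => j _.
  have [E|ne'] := eqVneq (al j) (- al i).
    rewrite memvZ // X_mem // unfold_in /= E (ipNr W) oppr_eq0 ne andbT.
    exact/asboolP.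
  by rewrite (root_space_orth HC HH hc (zrs j)) ?scale0r ?mem0v // eq_sym.
have sS : s \in stab.
  apply: memv_suml => i /eqP e0; rewrite memvZ // memv_ker.
  by have [-> _] := br_ivec (zrs' i); rewrite e0 scale0r oppr0.
have sm : s \in m by rewrite -[s](addrK y) memvB // (subvP X_sub).
have : s \in (m :&: stab)%VS by rewrite memv_cap sm.
by rewrite tangent_cap_stab memv0 => /eqP ->; rewrite add0r.
Qed.

Let X_basis : basis_of m X.
Proof. by rewrite /basis_of X_free eqEsubv X_sub X_span. Qed.

Let acs_stable (J : 'End(g)) : canonical_acs p gamma phi J ->
  forall x, x \in m -> J x \in m.
Proof.
move=> HJ x xm; rewrite (coord_basis X_basis xm) linear_sum; apply: memv_suml => j _.
rewrite linearZ /= memvZ // XE; have [pos ne] := IP j.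
have [-> _] := acs_root HJ pos ne (zrs' _).
by rewrite memvN memvZ //; have [] := root_tangent (zrs' (enum_val j)) ne.
Qed.

Let trace_acs (J : 'End(g)) t : canonical_acs p gamma phi J ->
  trace_on m (fun u => J (br g (vsval t) u)) =
  \sum_(i | i \in I) eps p (al i) * al i t.
Proof.
move=> HJ.
rewrite (@eq_trace_on _ _ _ _ ((J \o br g (vsval t))%VF)); last by move=> x _; rewrite comp_lfunE.
rewrite (trace_on_diag (c := fun j => eps p (al (enum_val j)) * al (enum_val j) t) X_basis).
  by rewrite [RHS]big_enum_val.
move=> j; rewrite XE comp_lfunE; have [pos ne] := IP j.
have [-> _] := root_space_brE t (zrs' (enum_val j)).
have [_ E] := acs_root HJ pos ne (zrs' (enum_val j)).
by rewrite linearZ /= E scalerA mulrC.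
Qed.

(** The conjugate of [a + i b] is its adjoint up to the sign [eps], and the
    bracket of [a + i b] with its conjugate is [- 2 i [a, b]]. *)
Lemma br_real_imaginary be a b : is_root be -> root_space be (a, b) ->
  br g a b = - (2^-1 * eps p be * Hc (a, b) (a, b)) *: vsval (hvec be).
Proof.
move=> rb h; have := cbr_adj HC HH h.
have E2 : cbr (a, b) (a, - b) = (0, - (2 *: br g a b)).
  congr (_, _); rewrite /= brNr; first by rewrite !br_alt !oppr0 addr0.
  by rewrite (brC b) -opprD scaler_nat mulr2n.
have [c|nn] := root_dichotomy HC HH rb.
  have [ta tb] := (in_kc_theta HC a b).1 (c _ h).
  rewrite (eps_compact rb c) /cx_adjoint /= ta tb.
  have -> : (- a, b) = - (a, - b) :> (g * g)%type by congr (_, _); rewrite /= opprK.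
  rewrite cbrNr E2 => /(congr1 snd) /=; rewrite opprK => E.
  rewrite mulrN1 mulNr opprK -[RHS]scalerA -E scalerA mulVf ?scale1r ?pnatr_eq0 //.
have [/= ap bp] := nn _ h.
rewrite (eps_noncompact nn) /cx_adjoint /= (theta_p HC ap) (theta_p HC bp) opprK.
rewrite E2 => /(congr1 snd) /= E.
rewrite mulr1 scaleNr -[X in - X]scalerA -E scalerN opprK scalerA mulVf ?scale1r ?pnatr_eq0 //.
Qed.

Variables (G : preTopologicalGroupType) (LG : lie_group g G).

(** The equation comes from evaluating the Chern-Ricci form on the real and
    imaginary parts [a, b] of a root vector. Their bracket lies in the Cartan
    subalgebra, so that the curvature is the commutator of two complex linear
    maps, whose product with [J] has trace zero, minus the isotropy action of
    [[a, b]], whose product with [J] is diagonal. *)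
Lemma special_root_equation : special_weight LG p gamma phi ->
  exists lam, forall be, positive_root gamma be -> wform phi be != 0 ->
  - lam * wform phi be =
  \sum_(i | `[< positive_root gamma (al i) >] && (wform phi (al i) != 0))
     eps p (al i) * wform (al i) be.
Proof.
move=> [J [L [HJ [[Lm _] _ LJ _] [lam E]]]]; exists lam => be pos ne.
have [[b0 [[a b] h e0]] _] := pos.
have [am bm] := root_tangent h ne.
have rb : is_root be by case: pos.
have Eab := br_real_imaginary rb h.
set t := vsval (hvec be) in Eab; set q := 2^-1 * _ * _ in Eab.
have abS : br g a b \in stab by rewrite Eab memvZ // h0_stab.
have := E _ _ am bm; rewrite /chern_ricci /kks.
have capS : (stab :&: m)%VS = 0%VS by rewrite capvC tangent_cap_stab.
have pm0 : pr_tangent v (br g a b) = 0 by apply: daddv_pi_0; rewrite ?tangent_cap_stab.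
have ps0 : pr_stab v (br g a b) = br g a b by apply: daddv_pi_id.
have stJ := acs_stable HJ.
have -> : trace_on m (fun u => J (curvature v L a b u)) =
   trace_on m (fun u => (J \o L a)%VF (L b u)) - trace_on m (fun u => (J \o L b)%VF (L a u))
   + q * trace_on m (fun u => J (br g t u)).
  rewrite -trace_onB -trace_onZ -trace_onD; apply: eq_trace_on => w wm.
  rewrite /curvature pm0 ps0 !comp_lfunE linear0 zero_lfunE subr0 Eab brZl.
  by rewrite linearB linearB linearZ /= scaleNr opprK.
(* [J] commutes with the connection, so that the two products have equal trace. *)
rewrite trace_on_comp; last 2 first.
- by move=> x xm; rewrite comp_lfunE stJ // Lm.
- by move=> x xm; apply: Lm.
rewrite (@eq_trace_on _ _ _ (fun u => L b ((J \o L a)%VF u)) (fun u => (J \o L b)%VF (L a u))).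
  rewrite subrr add0r (trace_acs _ HJ) Eab killingZr /ivec killingNl.
  rewrite -[killing _ _]opprK -/(killingR _ _) opprK => E'.
  have q0 : q != 0.
    rewrite /q !mulf_neq0 ?invr_eq0 ?pnatr_eq0 //; last by rewrite (ip_eq0 H).
    by rewrite /eps; case: ifP; rewrite ?oppr_eq0 oner_eq0.
  apply: (mulfI q0); rewrite mulNr; apply: etrans (etrans _ (esym E')) _.
    rewrite /wform; ring.
  congr (_ * _); apply: eq_big => i; first by [].
  by move=> _; rewrite (wformE HC HH).
by move=> w wm; rewrite !comp_lfunE LJ // Lm.
Qed.

End Curvature.
End OrbitGeometry.

(** * Compactness of the stabilizer *)
Section BoundedConvex.
Local Open Scope classical_set_scope.
Local Open Scope ring_scope.

(** A nonzero slope at some point is kept or exceeded in one direction, along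
    which the function outgrows any bound. *)
Lemma bounded_convex_derive0 (R : realType) (f f1 f2 : R -> R) (M : R) :
  (forall s : R, is_derive s 1 f (f1 s)) -> (forall s : R, is_derive s 1 f1 (f2 s)) ->
  (forall s, 0 <= f2 s) -> (forall s, f s <= M) -> forall s, f2 s = 0.
Proof.
move=> df df1 f2ge0 fM.
have cont (h h1 : R -> R) a b : (forall s : R, is_derive s 1 h (h1 s)) ->
    {within `[a, b]%classic, continuous h}.
  move=> dh; apply: derivable_within_continuous => x _.
  by have := dh x; case.
have nd a b : a <= b -> f1 a <= f1 b.
  move=> ab; have [|c _ E] := MVT_segment ab (fun x _ => df1 x); first exact: cont df1.
  by rewrite -subr_ge0 E mulr_ge0 // subr_ge0.
have f10 a : f1 a = 0.
  apply/eqP/negPn/negP => ne.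
  have [pos|neg|//] := ltgtP (f1 a) 0; last by move/eqP: ne.
  (* With slope [f1 a], the value [M + 1] would be reached at [b]. *)
  - pose b := a + (M + 1 - f a) / f1 a.
    have ba : b <= a.
      rewrite gerDl mulr_ge0_le0 ?invr_le0 ?(ltW pos) //.
      by have := fM a; lra.
    have [|c] := MVT_segment ba (fun x _ => df x); first exact: cont df.
    rewrite in_itv /= => /andP[_ ca] E.
    have h1 := nd _ _ ca.
    have E2 : f1 a * (a - b) = - (M + 1 - f a).
      by rewrite /b opprD addNKr mulrN mulrC mulfVK.
    have h2 : f1 c * (a - b) <= f1 a * (a - b) by rewrite ler_wpM2r // subr_ge0.
    have := fM b; lra.
  - pose b := a + (M + 1 - f a) / f1 a.
    have ab : a <= b.
      rewrite lerDl divr_ge0 ?(ltW neg) //.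
      by have := fM a; lra.
    have [|c] := MVT_segment ab (fun x _ => df x); first exact: cont df.
    rewrite in_itv /= => /andP[ac _] E.
    have h1 := nd _ _ ac.
    have E2 : f1 a * (b - a) = M + 1 - f a.
      by rewrite /b addrC addKr mulrC mulfVK.
    have h2 : f1 a * (b - a) <= f1 c * (b - a) by rewrite ler_wpM2r // subr_ge0.
    have := fM b; lra.
move=> s; have [_ <-] := df1 s.
have -> : f1 = cst 0 by apply: funext => x; rewrite f10.
exact: derive_cst.
Qed.

End BoundedConvex.

Section Group.
Local Open Scope classical_set_scope.
Local Open Scope ring_scope.
Variables (R : realType) (g : lie_algebra R) (k p : {vspace g}).
Hypothesis HC : cartan_decomposition k p.
Variables (G : preTopologicalGroupType) (LG : lie_group g G).
Implicit Types (x y u v : g) (s t : R).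

Let B := Bth_inner HC.
Local Notation Bth := (cartan_form k p).

Definition Adexp x s := Ad LG (gexp LG (s *: x)).

Lemma Adexp0 x u : Adexp x 0 u = u.
Proof.
have E : gexp LG (0 *: x) = 1%g.
  have := gexp_add LG 0 0 x; rewrite addr0 => E.
  by apply: (mulgI (gexp LG (0 *: x))); rewrite -E mulg1.
by rewrite /Adexp E Ad1 id_lfunE.
Qed.

Lemma AdexpD x s t u : Adexp x (s + t) u = Adexp x s (Adexp x t u).
Proof. by rewrite /Adexp gexp_add AdM comp_lfunE. Qed.

Lemma AdexpN x s u : Adexp (- x) s u = Adexp x (- s) u.
Proof. by rewrite /Adexp scalerN scaleNr. Qed.

(** Expanding in an orthonormal basis reduces the derivative of the product to
    derivatives of linear functions of the adjoint action. *)
Lemma Adexp_form (P Q : 'End(g)) x x' y y' t :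
  is_derive (t : R^o) 1
    (fun s : R^o => Bth (P (Adexp x s y)) (Q (Adexp x' s y')) : R^o)
    (Bth (P (br g x (Adexp x t y))) (Q (Adexp x' t y')) +
     Bth (P (Adexp x t y)) (Q (br g x' (Adexp x' t y')))).
Proof.
have [||n [e [w [_ _ esp]]]] := @orthonormal_joint_eigenbasis R g Bth B unit (fun=> 0).
- by move=> _ a b; rewrite !zero_lfunE (ip0l B) (ip0r B).
- by move=> _ _ a; rewrite !zero_lfunE.
have pars a b : Bth a b = \sum_i Bth (e i) a * Bth (e i) b.
  rewrite {1}(esp a) (ip_suml B); apply: eq_bigr => i _.
  by rewrite (ipZl B) (ipC B a).
have D1 (S : 'End(g)) a b i :
   is_derive (t : R^o) 1 (fun s : R^o => Bth (e i) (S (Adexp a s b)) : R^o)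
     (Bth (e i) (S (br g a (Adexp a t b)))).
  have := Ad_gexp LG (ip_form Bth (e i) \o S)%VF a b t.
  rewrite comp_lfunE (ip_formE B).
  by under eq_fun do rewrite comp_lfunE (ip_formE B).
pose F i (s : R^o) : R^o := Bth (e i) (P (Adexp x s y)).
pose F' i (s : R^o) : R^o := Bth (e i) (Q (Adexp x' s y')).
have -> : (fun s : R^o => Bth (P (Adexp x s y)) (Q (Adexp x' s y')) : R^o) =
   \sum_(i < n) (F i * F' i).
  by apply: funext => s; rewrite pars fct_sumE.
have D i := @is_deriveM R R^o (F i) (F' i) t 1 _ _ (D1 P x y i) (D1 Q x' y' i).
have Ds := @is_derive_sum R R^o R^o n (fun i => F i * F' i) t 1 _ D.
apply: (@is_derive_eq R R^o R^o _ _ _ _ _ Ds).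
rewrite /= !pars -big_split; apply: eq_bigr => i _.
rewrite /= /GRing.scale /=. ring.
Qed.

Variable x : g.
Hypothesis xp : x \in p.

Let brB y u : Bth (br g x y) u = Bth y (br g x u).
Proof. by rewrite (Bth_br HC) (theta_p HC xp) brNl (ipNr B) opprK. Qed.

(** The product of [Ad (exp (s x)) y] with [Ad (exp (- s x)) u'] has derivative
    zero, because [ad x] is symmetric for [x] in [p]. *)
Lemma Adexp_sym s y u : Bth (Adexp x s y) u = Bth y (Adexp x s u).
Proof.
pose u' := Adexp x s u.
have E : Adexp (- x) s u' = u by rewrite AdexpN -AdexpD addNr Adexp0.
have := @is_derive_0_is_cst R
  (fun s : R^o => Bth (\1%VF (Adexp x s y)) (\1%VF (Adexp (- x) s u'))) s 0.
rewrite !id_lfunE E !Adexp0; apply=> t.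
apply: is_derive_eq; first exact: Adexp_form.
by rewrite !id_lfunE brB brNl (ipNr B) subrr.
Qed.

Lemma Adexp_fix s v : br g x v = 0 -> Adexp x s v = v.
Proof.
move=> xv; apply: (ip_ext B) => y; rewrite Adexp_sym (ipC B v) (ipC B v).
have := @is_derive_0_is_cst R
  (fun s : R^o => Bth (\1%VF (Adexp x s y)) (\1%VF (Adexp 0 s v))) s 0.
have E t : Adexp 0 t v = v by rewrite /Adexp scaler0 -(scaler0 _ 0) Adexp0.
rewrite !id_lfunE !E !Adexp0; apply=> t.
apply: is_derive_eq; first exact: Adexp_form.
by rewrite !id_lfunE E brB xv br0l !(ip0r B) addr0.
Qed.

(** The squared norm of [Ad (exp (s x)) y] is a convex function of [s], its
    second derivative being [4 |[x, Ad (exp (s x)) y]|^2]. On a compact stabilizer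
    it is bounded, so that [[x, y] = 0] for all [y]; and the Killing form is
    definite on [p]. *)
Lemma compact_stabilizer_centralizer v :
  compact (stabilizer LG v) -> br g x v = 0 -> x = 0.
Proof.
move=> cS xv.
have inS s : stabilizer LG v (gexp LG (s *: x)) by apply: Adexp_fix.
have xy y : br g x y = 0.
  have S0 : stabilizer LG v !=set0 by exists (gexp LG (0 *: x)); apply: inS.
  have [|c _ hM] := @compact_EVT_max _ R (fun a => ip_form Bth y (Ad LG a y)) _ S0 cS.
    exact/continuous_subspaceT/Ad_continuous.
  pose f s := Bth (\1%VF (Adexp x s y)) (\1%VF (Adexp x s y)).
  pose f1 s := 2 * Bth ((br g x) (Adexp x s y)) (\1%VF (Adexp x s y)).
  pose f2 s := 4 * Bth (br g x (Adexp x s y)) (br g x (Adexp x s y)).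
  have h s : f2 s = 0.
    apply: (@bounded_convex_derive0 _ f f1 f2 (ip_form Bth y (Ad LG c y))) => {s} s.
    - apply: is_derive_eq; first exact: Adexp_form.
      rewrite /f1 !id_lfunE (ipC B (Adexp x s y)); ring.
    - rewrite /f1; apply: is_derive_eq.
        by apply: is_deriveZ; apply: Adexp_form.
      rewrite /f2 !id_lfunE !brB /GRing.scale /=; ring.
    - by rewrite mulr_ge0 // (ip_ge0 B).
    - rewrite /f !id_lfunE Adexp_sym -AdexpD.
      have := hM (gexp LG ((s + s) *: x)); rewrite inE => /(_ (inS _)).
      by rewrite !(ip_formE B).
  have := h 0; rewrite /f2 Adexp0 => /eqP.
  by rewrite mulf_eq0 pnatr_eq0 /= (ip_eq0 B) => /eqP.
apply/eqP; apply/negPn/negP => x0; have [_ _ _ _ /(_ x xp x0)] := HC.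
rewrite /killing (@eq_trace_on _ _ _ _ (fun u => 0 *: u)).
  by rewrite trace_onZ mul0r ltxx.
by move=> u _; rewrite xy scale0r.
Qed.

End Group.

Section NoncompactRoots.
Variables (R : realType) (g : lie_algebra R) (k p h0 : {vspace g}).
Hypothesis HC : cartan_decomposition k p.
Hypothesis HH : compact_cartan k h0.
Variables (l : nat) (gamma : 'I_l -> weight R h0).
Variable phi : weight R h0.
Variables (G : preTopologicalGroupType) (LG : lie_group g G).

(** Otherwise the root plane would contain noncompact elements that commute with
    the base point. *)
Lemma compact_stabilizer_root : compact (stabilizer LG (ivec phi)) ->
  forall be, positive_root gamma be -> noncompact_root p be -> wform phi be != 0.
Proof.
move=> cS be [[b0 [[a b] h ne]] _] nb; apply/eqP => fb.
have [/= ap _] := nb _ h.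
have [Ea _] := br_ivec HC HH phi h.
have a0 : a = 0.
  apply: (compact_stabilizer_centralizer HC ap cS).
  by rewrite brC Ea fb scale0r oppr0 oppr0.
case/eqP: ne; congr (_, _); first exact: a0.
have [t t0] : exists t, be t != 0.
  apply/not_existsP => h'; case/eqP: b0; apply/lfunP => t.
  by rewrite zero_lfunE; apply/eqP/negPn/negP/h'.
apply: (scalerI t0); have [<- _] := root_space_brE t h.
by rewrite a0 br0r scaler0.
Qed.

End NoncompactRoots.

(** * Highest roots of the classical diagrams *)
Lemma entry_diag X l i : classical_cartan_entry X l i i = 2.
Proof. by rewrite /classical_cartan_entry eqxx. Qed.

Lemma entry_offdiag_le0 X l i j : i != j -> classical_cartan_entry X l i j <= 0.
Proof.
move=> /negPf ij; rewrite /classical_cartan_entry ij.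
by case: X; do ?case: ifP => _; rewrite ?oppr_le0 ?ler0n.
Qed.

(** Off-diagonal entries are nonpositive, so a few neighbours of a node are
    enough to bound the product with its simple root from above. *)
Lemma entry_bound X l (c : nat -> nat) i (N : seq nat) :
  uniq (i :: N) -> all (fun j => j < l)%N (i :: N) ->
  \sum_(j < l) (c j)%:R * classical_cartan_entry X l i j <=
  \sum_(j <- i :: N) (c j)%:R * classical_cartan_entry X l i j :> int.
Proof.
set M := i :: N; move=> uM aM.
pose F (j : nat) : int := (c j)%:R * classical_cartan_entry X l i j.
rewrite -[leLHS]/(\sum_(j < l) F j) -[leRHS]/(\sum_(j <- M) F j).
rewrite -(big_mkord xpredT F) (bigID (mem M)) /=.
have -> : \sum_(j <- M) F j = \sum_(0 <= j < l | j \in M) F j.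
  rewrite -[RHS]big_filter; apply: perm_big; apply: uniq_perm => //.
    by rewrite filter_uniq // iota_uniq.
  move=> j; rewrite mem_filter mem_index_iota /=.
  by case: (boolP (j \in M)) => // /(allP aM) ->.
rewrite gerDl; apply: sumr_le0 => j jM; rewrite mulr_ge0_le0 ?ler0n //.
by apply: entry_offdiag_le0; apply: contraNneq jM => <-; rewrite mem_head.
Qed.

Lemma entryB l i j : chain_edge i j -> (0 < i)%N -> classical_cartan_entry TypeB l i j = -1.
Proof.
move=> e i0; rewrite /classical_cartan_entry e.
by case: eqP => [E|_]; [move: e; rewrite /chain_edge E; lia | case: i i0 {e}].
Qed.

Lemma entryC l i j : chain_edge i j -> (j.+1 < l)%N -> classical_cartan_entry TypeC l i j = -1.
Proof.
move=> e jl; rewrite /classical_cartan_entry e.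
case: eqP => [E|_]; first by move: e; rewrite /chain_edge E; lia.
by rewrite (ltn_eqF jl) andbF.
Qed.

Lemma entryC2 l i : i.+2 = l -> classical_cartan_entry TypeC l i i.+1 = -2.
Proof.
move=> e; rewrite /classical_cartan_entry e eqxx /=.
by case: eqP => // E; move: E; lia.
Qed.

Lemma entryD l i j : chain_edge i j -> (i.+1 < l)%N -> (j.+1 < l)%N ->
  classical_cartan_entry TypeD l i j = -1.
Proof.
move=> e il jl; rewrite /classical_cartan_entry e il jl.
by case: eqP => [E|_] //; move: e; rewrite /chain_edge E; lia.
Qed.

Lemma entryD_fork l i j : i.+3 = l -> j.+1 = l -> classical_cartan_entry TypeD l i j = -1.
Proof.
move=> il jl; rewrite /classical_cartan_entry il jl !eqxx orbT orbT.
by case: eqP => [E|_] //; move: il jl; rewrite E; lia.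
Qed.

(** [Rt c] abstracts from the statement that the combination of the simple roots
    with coefficients [c] is a root. The coefficients are functions on all
    natural numbers, of which only the values below [l] matter, to keep ordinals
    out of the computations. *)
Section HighestRoots.
Variables (X : classical_type) (l : nat) (Rt : (nat -> nat) -> Prop).
Local Notation entry := (classical_cartan_entry X l).
Hypothesis Rt_ext : forall c d, (forall j, (j < l)%N -> c j = d j) -> Rt c -> Rt d.
Hypothesis Rt_simple : forall i, (i < l)%N -> Rt (fun j => (j == i)%N).
Hypothesis Rt_add : forall c i, (i < l)%N -> Rt c ->
  \sum_(j < l) (c j)%:R * entry i j <= -1 -> Rt (fun j => c j + (j == i))%N.
Hypothesis Rt_add2 : forall c i, (i < l)%N -> Rt c ->
  \sum_(j < l) (c j)%:R * entry i j <= -2 -> Rt (fun j => c j + 2 * (j == i))%N.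

Let step (c d : nat -> nat) i N : (i < l)%N -> Rt c ->
  uniq (i :: N) -> all (fun j => j < l)%N N ->
  (c i)%:R * 2 + \sum_(j <- N) (c j)%:R * entry i j <= -1 ->
  (forall j, (j < l)%N -> d j = (c j + (j == i))%N) -> Rt d.
Proof.
move=> il rc u a le dE; apply: Rt_ext (Rt_add il rc _) => [j jl|]; first by rewrite dE.
apply: le_trans (entry_bound X c u _) _; first by rewrite /= il.
by rewrite big_cons entry_diag.
Qed.

Let step2 (c d : nat -> nat) i N : (i < l)%N -> Rt c ->
  uniq (i :: N) -> all (fun j => j < l)%N N ->
  (c i)%:R * 2 + \sum_(j <- N) (c j)%:R * entry i j <= -2 ->
  (forall j, (j < l)%N -> d j = (c j + 2 * (j == i))%N) -> Rt d.
Proof.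
move=> il rc u a le dE; apply: Rt_ext (Rt_add2 il rc _) => [j jl|]; first by rewrite dE.
apply: le_trans (entry_bound X c u _) _; first by rewrite /= il.
by rewrite big_cons entry_diag.
Qed.

Lemma down_ind (P : nat -> Prop) a b : (a <= b)%N -> P b ->
  (forall m, (a <= m)%N -> (m < b)%N -> P m.+1 -> P m) -> P a.
Proof.
move=> ab Pb h; have [n E] : exists n, b = (a + n)%N by exists (b - a)%N; lia.
elim: n a ab h E => [|n IH] a ab h E; first by rewrite E addn0 in Pb.
apply: (h) => //; [lia | apply: IH; [lia| |lia]].
by move=> m am mb; apply: h; lia.
Qed.

(** In the usual coordinates [gamma_0 = e_0] and [gamma_j = e_j - e_(j-1)]. The
    construction goes from [e_(l-1) - e_(l-2)] down to [e_(l-1) - e_0], then to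
    [e_(l-1) + e_0], and up to [e_(l-1) + e_i]. *)
Lemma root_coef2_B i : X = TypeB -> (i.+1 < l)%N -> exists2 c, Rt c & c i = 2%N.
Proof.
move=> XB il; have step1 := step; have step1' := step2; rewrite {}XB in step1 step1'.
(* The root [e_(l-1) - e_0]. *)
have h1 : Rt (fun j => (1 <= j)%N : nat).
  apply: (@down_ind (fun m => Rt (fun j => (m <= j)%N : nat)) 1 l.-1); first by lia.
    by apply: Rt_ext (Rt_simple (i := l.-1) _); [move=> j jl /= | ]; lia.
  move=> m m1 ml; move/step1 => h; apply: (h _ m [:: m.+1]) => //=.
  - by lia.
  - by rewrite inE; lia.
  - by lia.
  - by rewrite big_seq1 entryB ?/chain_edge ?eqxx // leqnn ltnn.
  - by move=> j jl; lia.
(* The root [e_(l-1) + e_0]. *)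
have h2 : Rt (fun j => if (j <= 0)%N then 2%N else 1%N).
  move/step1': h1 => h; apply: (h _ 0%N [:: 1%N]) => //=.
  - by lia.
  - by lia.
  - by rewrite big_seq1 /classical_cartan_entry /=; lia.
  - by move=> [|j] //=.
exists (fun j => if (j <= i)%N then 2%N else 1%N); last by rewrite leqnn.
elim: i il => [|i IH] il //.
have {}IH := IH (ltnW il).
move/step1: IH => h; apply: (h _ i.+1 [:: i; i.+2]) => //=.
- by lia.
- by rewrite !inE; lia.
- by lia.
- rewrite big_cons big_seq1 !entryB // /chain_edge ?eqxx ?orbT // leqnn ltnn.
  by rewrite leqNgt ltnS leqnSn.
- by move=> j jl; do 2![case: leqP => ?]; case: eqP => ? /=; lia.
Qed.

(** In the usual coordinates, the long roots [2 e_m] for decreasing [m]. *)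
Lemma root_coef2_C i : X = TypeC -> (i.+1 < l)%N -> exists2 c, Rt c & c i = 2%N.
Proof.
move=> XC il; have step1 := step2; rewrite {}XC in step1.
exists (fun j => 2 * ((i <= j)%N && (j.+1 < l)%N) + (j.+1 == l))%N; last by lia.
apply: (@down_ind (fun m => Rt (fun j => 2 * ((m <= j)%N && (j.+1 < l)%N) + (j.+1 == l))%N) i l.-1); first by lia.
  by apply: Rt_ext (Rt_simple (i := l.-1) _); [move=> j jl /= | ]; lia.
move=> m imul ml; move/step1 => h; apply: (h _ m [:: m.+1]) => //=.
- by lia.
- by rewrite inE; lia.
- by lia.
- rewrite big_seq1 ltnn leqnn.
  have [e|ne] := eqVneq m.+2 l.
    by rewrite entryC2 // -e ltnn (ltn_eqF (ltnSn _)).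
  have m2 : (m.+2 < l)%N by lia.
  by rewrite entryC ?/chain_edge ?eqxx // m2 (ltn_eqF (ltnW m2)).
- by move=> j jl; lia.
Qed.

(** In the usual coordinates [gamma_j = e_j - e_(j+1)], except for the last one,
    [e_(l-2) + e_(l-1)]. The construction goes from the latter to
    [e_0 + e_(l-1)], then to [e_0 + e_(l-2)] and up to [e_0 + e_i]. *)
Lemma root_coef2_D i : X = TypeD -> (0 < i)%N -> (i.+2 < l)%N -> exists2 c, Rt c & c i = 2%N.
Proof.
move=> XD i0 il; have step1 := step; rewrite {}XD in step1.
(* The root [e_0 + e_(l-1)]. *)
have h1 : Rt (fun j => ((0 <= j)%N && (j.+2 < l)%N) + (j.+1 == l))%N.
  apply: (@down_ind (fun m => Rt (fun j => ((m <= j)%N && (j.+2 < l)%N) + (j.+1 == l))%N) 0 (l - 2)); first by lia.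
    by apply: Rt_ext (Rt_simple (i := l.-1) _); [move=> j jl /= | ]; lia.
  move=> m _ ml; move/step1 => h.
  have [e|ne] := eqVneq m.+3 l.
    apply: (h _ m [:: m.+2]) => //=; rewrite ?inE; try lia.
    rewrite big_seq1 entryD_fork // -e ltnn. 
    by rewrite (ltn_eqF (leqW (ltnSn _))) (leq_gtF (leqnSn _)) andbF eqxx.
  have m3 : (m.+3 < l)%N by lia.
  apply: (h _ m [:: m.+1]) => //=; rewrite ?inE; try lia.
  by rewrite big_seq1 entryD ?/chain_edge ?eqxx ?(ltnW m3) ?(ltnW (ltnW m3)) // ltnn leqnn m3
    (ltn_eqF (ltnW m3)) (ltn_eqF (ltnW (ltnW m3))).
(* The root [e_0 + e_(l-2)]. *)
have h2 : Rt (fun j => 1%N).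
  have [q E] : exists q, l = q.+3 by exists (l - 3)%N; lia.
  move/step1: h1 => h; apply: (h _ q.+1 [:: q]) => //=; rewrite ?inE; try lia.
  rewrite big_seq1 entryD ?/chain_edge ?eqxx ?orbT ?E // ltnn ltnSn.
  by rewrite (ltn_eqF (ltnSn _)) (ltn_eqF (leqW (ltnSn _))).
exists (fun j => 1 + ((i <= j)%N && (j.+2 < l)%N))%N; last by lia.
apply: (@down_ind (fun m => Rt (fun j => 1 + ((m <= j)%N && (j.+2 < l)%N))%N) i (l - 2)); first by lia.
  by apply: Rt_ext h2 => j jl; lia.
move=> m imul ml; move/step1 => h.
case: m imul ml h => [|m] imul ml h; first by lia.
have [e|ne] := eqVneq m.+4 l.
  apply: (h _ m.+1 [:: m.+2; m.+3; m]) => //=; rewrite ?inE; try lia.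
  - rewrite !big_cons big_nil (@entryD_fork l m.+1 m.+3) //= !entryD ?/chain_edge ?eqxx ?orbT // -?e //.
    by rewrite !ltnn (leq_gtF (leqnSn m)) (leq_gtF (leqnSn m.+4)) !andbF.
  - lia.
have m4 : (m.+4 < l)%N by lia.
apply: (h _ m.+1 [:: m.+2; m]) => //=; rewrite ?inE; try lia.
rewrite !big_cons big_nil !entryD ?/chain_edge ?eqxx ?orbT ?(ltnW m4) ?(ltnW (ltnW m4)) ?(ltnW (ltnW (ltnW m4))) //.
by rewrite /= ltnn leqnn m4 (leq_gtF (leqnSn m)).
Qed.

(** At an unlisted node, other than the last one in type D, some root has
    coefficient two. The last node in type D is equivalent to the preceding one
    by the symmetry of the fork. *)
Lemma coef_le1_listed (s : 'I_l) : (forall c, Rt c -> (c s <= 1)%N) ->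
  listed_node X s \/ X = TypeD /\ s.+1 = l.
Proof.
move=> le1; have no2 : ~ exists2 c, Rt c & c s = 2%N.
  by move=> [c /le1 h E]; rewrite E in h.
have sl := ltn_ord s.
case E : X => /=.
- by left.
- left; apply/eqP; have [|lt|//] := ltngtP s.+1 l; last by lia.
  by move=> /(root_coef2_B E)/no2.
- left; apply/eqP; have [|lt|//] := ltngtP s.+1 l; last by lia.
  by move=> /(root_coef2_C E)/no2.
have [s0|s0] := posnP s; first by left; rewrite s0.
have [h|h|h] := ltngtP s.+2 l.
- by have /no2 := root_coef2_D E s0 h.
- by right; split=> //; lia.
- by left; rewrite orbT.
Qed.

End HighestRoots.

Lemma fork_symmetry l (a b : 'I_l) : a.+2 = l -> b.+1 = l -> (3 <= l)%N ->
  dynkin_iso (classical_cartan TypeD l) (classical_cartan TypeD l) (tperm a b).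
Proof.
move=> Ea Eb l3 i j; rewrite !mxE /classical_cartan_entry.
have E (i' j' : 'I_l) : (i' == j' :> nat) = (i' == j') by [].
rewrite !E (inj_eq perm_inj); case: eqP => // ij; congr (- (nat_of_bool _)%:R).
have il := ltn_ord i; have jl := ltn_ord j.
rewrite /chain_edge.
case: tpermP => [ei|ei|/eqP nai /eqP nbi]; case: tpermP => [ej|ej|/eqP naj /eqP nbj];
  rewrite ?ei ?ej; move: ij; rewrite -?val_eqE /= => ij;
  try (move: nai nbi; rewrite -!val_eqE /= => nai nbi);
  try (move: naj nbj; rewrite -!val_eqE /= => naj nbj); try lia.
all: by [subst i j; case: ij].
Qed.

(** * Fundamental weights and the classification *)
Section FundamentalWeights.
Variables (R : realType) (g : lie_algebra R) (k p h0 : {vspace g}).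
Hypothesis HC : cartan_decomposition k p.
Hypothesis HH : compact_cartan k h0.
Variables (l : nat) (gamma : 'I_l -> weight R h0).
Hypothesis HS : simple_roots gamma.
Let W := wform_inner HC HH.
Local Notation A := (cartan_matrix gamma).

Lemma wform_simple_eq0 (psi : weight R h0) :
  (forall i, wform psi (gamma i) = 0) -> psi = 0.
Proof.
move=> h; apply/eqP; rewrite -(ip_eq0 W) {2}(simple_root_coords HS psi) (ip_sumr W).
by rewrite big1 // => i _; rewrite (ipZr W) h mulr0.
Qed.

Lemma cartan_row (x : 'I_l -> R) i :
  \sum_j A i j * x j =
  2 * wform (\sum_j x j *: gamma j) (gamma i) / wform (gamma i) (gamma i).
Proof.
rewrite (ip_suml W) mulr_sumr mulr_suml; apply: eq_bigr => j _.
by rewrite mxE (ipZl W) (ipC W (gamma j)) mulrC !mulrA (mulrC (x j)).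
Qed.

(** A vector in the kernel gives a weight orthogonal to all simple roots, and
    the form on weights is definite. *)
Lemma cartan_unit : A \in unitmx.
Proof.
rewrite -unitmx_tr -row_free_unit -kermx_eq0; apply/rowV0P => u /sub_kermxP /rowP uA.
have : \sum_j u 0 j *: gamma j = 0.
  apply: wform_simple_eq0 => i; have := uA i; rewrite !mxE.
  under eq_bigr => j _ do rewrite mxE mulrC.
  rewrite (cartan_row (u 0)) => /eqP.
  have /gt_eqF g0 := simple_wform_gt0 HC HH HS i.
  by rewrite mulf_eq0 invr_eq0 g0 orbF mulf_eq0 pnatr_eq0 /= => /eqP.
by move/(simple_roots_free HS) => h; apply/rowP => j; rewrite h mxE.
Qed.

(** The coordinates of the weight in the simple roots solve a linear system
    whose matrix is the Cartan matrix and whose right-hand side has a single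
    nonzero entry. *)
Lemma fundamental_weight_multiple (phi : weight R h0) s :
  (forall i, i != s -> wform phi (gamma i) = 0) ->
  phi = (2 * wform phi (gamma s) / wform (gamma s) (gamma s)) *:
        fundamental_weight gamma s.
Proof.
move=> h; set d := _ / _.
pose x i := coord (map_tuple gamma (ord_tuple l)) i phi.
have Ephi : phi = \sum_i x i *: gamma i := simple_root_coords HS phi.
have Ax : A *m \col_j x j = d *: delta_mx s 0.
  apply/colP => i; rewrite !mxE.
  under eq_bigr => j _ do rewrite [X in _ * X]mxE.
  rewrite cartan_row -Ephi andbT; have [->|ne] := eqVneq i s; first by rewrite mulr1.
  by rewrite h // mulr0 mul0r mulr0.
have Ex : \col_j x j = d *: (invmx A *m delta_mx s 0).
  by rewrite -(mulKmx cartan_unit (\col_j x j)) Ax -scalemxAr.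
rewrite {1}Ephi /fundamental_weight scaler_sumr; apply: eq_bigr => i _.
have /colP /(_ i) := Ex; rewrite mxE => ->.
rewrite mxE scalerA; congr (_ *: _); congr (_ * _).
by rewrite -colE mxE.
Qed.

End FundamentalWeights.

Theorem theorem8p8 (R : realType) (g : lie_algebra R) (k p h0 : {vspace g})
    (l : nat) (gamma : 'I_l -> weight R h0) (D : vogan_diagram l)
    (G : preTopologicalGroupType) (LG : lie_group g G) (phi : weight R h0) :
  semisimple g ->
  cartan_decomposition k p ->
  compact_cartan k h0 ->
  simple_roots gamma ->
  has_vogan_diagram p gamma D ->
  of_classical_type D ->
  #|vd_painted D| = 1%N ->
  dominant gamma phi ->
  compact (stabilizer LG (ivec phi)) ->
  special_weight LG p gamma phi ->
  integrable_weight p gamma phi ->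
  (exists (X : classical_type) (i : 'I_l),
     [/\ classical_rank X l, listed_node X i
       & vogan_iso D (VoganDiagram (classical_cartan X l) [set i]%SET)]) /\
  (forall j : 'I_l, j \in vd_painted D ->
     exists2 c : R, 0 < c & phi = c *: fundamental_weight gamma j).
Proof.
move=> _ HC HH HS [HV1 HV2] [X [sg [rk iso]]] /eqP/cards1P[s Ds] dom cS sp int.
have nc_s : noncompact_root p (gamma s) by apply/HV2; rewrite Ds set11.
have c_ns i : i != s -> compact_root k (gamma i).
  move=> nis; have [//|nc] := root_dichotomy HC HH (simple_is_root HS i).
  by move/HV2: nc; rewrite Ds inE (negPf nis).
have nc_phi := compact_stabilizer_root (gamma := gamma) HC HH cS.
have pp0 := integrable_noncompact_commute HC HH HS dom nc_phi int.
split; last first.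
  move=> j; rewrite Ds inE => /eqP -> {j}.
  have [n [z [al [zrs zon zsp]]]] := weight_basis HC HH.
  have [lam eqn] := special_root_equation HC HH HS zrs zon zsp sp.
  have h := unpainted_orthogonal HC HH HS nc_s c_ns pp0 zrs zon zsp dom nc_phi eqn.
  exists (2 * wform phi (gamma s) / wform (gamma s) (gamma s)).
    rewrite divr_gt0 ?mulr_gt0 ?ltr0n ?(simple_wform_gt0 HC HH HS) //.
    rewrite lt_neqAle eq_sym nc_phi ?dom //; exact: simple_positive.
  exact: (fundamental_weight_multiple HC HH HS).
(* [sg] identifies the nodes with those of the standard diagram, in which the
   coefficients [c] are indexed by natural numbers. *)
pose Rt (c : nat -> nat) := is_root (comb gamma (fun i => c (sg i))).
have cartan_sum (c : nat -> nat) i :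
    \sum_(j < l) (c (sg j))%:R * cartan_matrix gamma (sg^-1 i)%g j =
    (\sum_(j < l) (c j)%:R * classical_cartan_entry X l i j)%:~R.
  rewrite [in RHS](reindex_inj (@perm_inj _ sg)) /= rmorph_sum /=; apply: eq_bigr => j _.
  by rewrite HV1 -iso permKV mxE rmorphM /= rmorph_nat.
have Rt_ext c d : (forall j, (j < l)%N -> c j = d j) -> Rt c -> Rt d.
  move=> cd; rewrite /Rt (_ : (fun i => c (sg i)) = (fun i => d (sg i))) //.
  by apply: funext => i; apply: cd.
have Rt_delta i (il : (i < l)%N) : (fun j => (sg j == i :> nat) : nat) =
    delta (sg^-1 (Ordinal il))%g.
  apply: funext => j; rewrite /delta; congr nat_of_bool.
  by rewrite -(inj_eq (@perm_inj _ sg) j) permKV.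
have Rt_simple i : (i < l)%N -> Rt (fun j => (j == i)%N).
  move=> il; rewrite /Rt (Rt_delta i il) comb_delta; exact: simple_is_root.
have Rt_add c i : (i < l)%N -> Rt c ->
  \sum_(j < l) (c j)%:R * classical_cartan_entry X l i j <= -1 ->
  Rt (fun j => c j + (j == i))%N.
  move=> il rc le.
  have := comb_add_simple HC HH HS (i := (sg^-1 (Ordinal il))%g) rc.
  rewrite cartan_sum /= -(ler_int R) in le *; move/(_ le).
  by rewrite /Rt -(Rt_delta i il).
have Rt_add2 c i : (i < l)%N -> Rt c ->
  \sum_(j < l) (c j)%:R * classical_cartan_entry X l i j <= -2 ->
  Rt (fun j => c j + 2 * (j == i))%N.
  move=> il rc le.
  have := comb_add_simple2 HC HH HS (i := (sg^-1 (Ordinal il))%g) rc.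
  rewrite cartan_sum /= -(ler_int R) in le *; move/(_ le).
  by rewrite /Rt -(Rt_delta i il).
have le1 c : Rt c -> (c (sg s) <= 1)%N.
  by move=> rc; have [] := painted_coef HC HH HS nc_s c_ns pp0 rc.
have [li|[XD sl]] := coef_le1_listed Rt_ext Rt_simple Rt_add Rt_add2 le1.
  exists X, (sg s); split=> //; exists sg; split=> //=.
  by rewrite Ds imset_set1.
(* The painted node is the last one of type D: swap the two ends of the fork. *)
rewrite {}XD /= in rk iso; have l2 : (l - 2 < l)%N by lia.
pose a := Ordinal l2.
have aE : a.+2 = l by rewrite /=; lia.
exists TypeD, a; split=> //=; first by rewrite aE eqxx orbT.
exists (sg * tperm a (sg s))%g; split=> /= [i j|].
  by rewrite !permM -iso; apply: fork_symmetry.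
by rewrite Ds imset_set1 permM tpermR.
Qed.
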